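(* Let $(M,K)$ be an $n$-dimensional Cartan space. Then the vertical Liouville-Hamilton distribution $V_{C^*}$ on $T^*M_0$ is integrable, and hence it defines a foliation on $T^*M_0$ (denoted by $\mathcal{F}_{V_{C^*}}$).
   Context: Summation convention is used; indices run from $1$ to $n$. $M$ is an $n$-dimensional $C^\infty$ manifold, $(x^i)$ local coordinates on $M$, $(x^i,p_i)$ the induced local coordinates on $T^*M$, and $T^*M_0=T^*M-\{\text{zero section}\}$. A Cartan structure on $M$ is a function $K:T^*M\to[0,\infty)$ such that (i) $K$ is $C^\infty$ on $T^*M_0$; (ii) $K(x,\lambda p)=\lambda K(x,p)$ for all $\lambda>0$; (iii) the matrix $(g^{ij})$, $g^{ij}=\frac12\frac{\partial^2K^2}{\partial p_i\partial p_j}$, is positive definite at all points of $T^*M_0$. (In fact $K(x,p)>0$ for $p\neq 0$.) The pair $(M,K)$ is a Cartan space. The inverse matrix of $(g^{ij})$ is $(g_{ij})$, and $p^i=\frac12\frac{\partial K^2}{\partial p_i}=g^{ij}p_j$. The canonical nonlinear connection has coefficients $N_{ij}=\gamma^0_{ij}-\frac12\gamma^0_{h0}\frac{\partial g_{ij}}{\partial p_h}$, where $\gamma^i_{jk}=\frac12g^{is}\left(\frac{\partial g_{js}}{\partial x^k}+\frac{\partial g_{sk}}{\partial x^j}-\frac{\partial g_{jk}}{\partial x^s}\right)$, $\gamma^0_{jk}=\gamma^i_{jk}p_i$, $\gamma^0_{j0}=\gamma^i_{jk}p_ip^k$. The horizontal distribution $H(T^*M_0)$ is locally spanned by $\frac{\delta}{\delta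 x^i}=\frac{\partial}{\partial x^i}+N_{ij}\frac{\partial}{\partial p_j}$, and the vertical distribution $V(T^*M_0)$ (kernel of the differential of the projection to $M$) by $\frac{\partial}{\partial p_i}$; the coframe dual to $\{\frac{\delta}{\delta x^i},\frac{\partial}{\partial p_i}\}$ is $\{dx^i,\delta p_i=dp_i-N_{ji}dx^j\}$. The Riemannian metric on $T^*M_0$ is $G=g_{ij}dx^i\otimes dx^j+g^{ij}\delta p_i\otimes\delta p_j$. The vertical Liouville-Hamilton vector field is $C^*=p_i\frac{\partial}{\partial p_i}$; $\{C^*\}$ is the line distribution it spans. The vertical Liouville(-Hamilton) distribution $V_{C^*}$ is the $G$-orthogonal complement of $\{C^*\}$ in $V(T^*M_0)$, i.e. $\Gamma(V_{C^*})=\{X\in\Gamma(V(T^*M_0)):\zeta(X)=0\}$ with $\zeta(X)=\frac1KG(X,C^* )$. *)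

(* Defs.v *)
From HB Require Import structures.
From mathcomp Require Import all_boot all_order all_algebra.
From mathcomp Require Import all_classical all_reals all_analysis.

Set Implicit Arguments.
Unset Strict Implicit.
Unset Printing Implicit Defensive.

Import Order.TTheory GRing.Theory Num.Theory.
Import numFieldNormedType.Exports.

Local Open Scope classical_set_scope.
Local Open Scope ring_scope.

Section Smoothness.
Context {R : realType} {m : nat} {W : normedModType R}.

Fixpoint Ck (k : nat) (U : set 'rV[R]_m) (f : 'rV[R]_m -> W) : Prop :=
  (forall u, U u -> {for u, continuous f}) /\
  if k is k'.+1 then
    forall a : 'I_m, (forall u, U u -> derivable f u (delta_mx 0 a)) /\
                     Ck k' U ('D_(delta_mx 0 a) f)
  else True.

(* Only used for open [U]. *)
Definition smooth_on (U : set 'rV[R]_m) (f : 'rV[R]_m -> W) : Prop :=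
  forall k, Ck k U f.

End Smoothness.

(* An indexed family of m-dimensional charts on subsets of T; [crd A i] is only
   meaningful on [dom A i].  The space carrying the atlas is the union of the
   chart domains, which may be a proper subset of T (as for T*M minus the zero
   section inside T*M). *)
Record atlas (R : realType) (T : Type) (m : nat) := Atlas {
  idx : Type;
  dom : idx -> set T;
  crd : idx -> T -> 'rV[R]_m }.

Arguments dom {R T m} a i _.
Arguments crd {R T m} a i _.

Definition space {R : realType} {T : Type} {m : nat} (A : atlas R T m) : set T :=
  [set z | exists i, dom A i z].

(* The local expression f o (crd A i)^-1, extended by 0 off the image. *)
Definition loc {R : realType} {T : Type} {m : nat} (A : atlas R T m) {W : normedModType R}
    (i : idx A) (f : T -> W) (u : 'rV[R]_m) : W :=
  xget 0 [set f z | z in [set z | dom A i z /\ crd A i z = u]].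

Section AtlasMaps.
Context {R : realType} {T T' : Type} {m m' : nat}.
Implicit Types (A : atlas R T m) (B : atlas R T' m').

(* For A and B smooth atlases, openness of the sets below is continuity of f. *)
Definition smooth_map A B (f : T -> T') : Prop :=
  (forall z, space A z -> space B (f z)) /\
  forall i j, let U := crd A i @` (dom A i `&` f @^-1` dom B j) in
    open U /\ smooth_on U (loc i (crd B j \o f)).

(* Tangent vectors are families of components, one row for each chart; only the
   charts around the base point matter.  This is the relation w = df_z(v). *)
Definition differential {A B} (f : T -> T') (z : T)
    (v : idx A -> 'rV[R]_m) (w : idx B -> 'rV[R]_m') : Prop :=
  forall i j, dom A i z -> dom B j (f z) ->
    w j = 'D_(v i) (loc i (crd B j \o f)) (crd A i z).

End AtlasMaps.

Section Manifolds.
Context {R : realType}.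

Definition smooth_manifold {M : topologicalType} {n : nat} (A : atlas R M n) : Prop :=
  [/\ hausdorff_space M, @second_countable M, space A = setT,
      forall i, [/\ open (dom A i), {in dom A i &, injective (crd A i)},
        {within dom A i, continuous (crd A i)} &
        forall O, open O -> O `<=` dom A i -> open (crd A i @` O)] &
      smooth_map A A id].

Context {T : Type} {m : nat} (A : atlas R T m).

(* The contravariant transformation law v^j = d(x^j)/d(x^i) v^i. *)
Definition tangent_at (z : T) (v : idx A -> 'rV[R]_m) : Prop :=
  differential id z v v.

End Manifolds.

Section Distributions.
Context {R : realType} {T : Type} {m : nat} (A : atlas R T m).

Definition tangent_distribution := T -> set (idx A -> 'rV[R]_m).

Definition vector_field (X : T -> idx A -> 'rV[R]_m) : Prop :=
  (forall z, space A z -> tangent_at z (X z)) /\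
  forall i, smooth_on (crd A i @` dom A i) (loc i (X ^~ i)).

Definition smooth_section (D : tangent_distribution) (X : T -> idx A -> 'rV[R]_m) : Prop :=
  vector_field X /\ forall z, space A z -> D z (X z).

Definition bracket (X Y : T -> idx A -> 'rV[R]_m) (z : T) (i : idx A) : 'rV[R]_m :=
  'D_(X z i) (loc i (Y ^~ i)) (crd A i z) -
  'D_(Y z i) (loc i (X ^~ i)) (crd A i z).

Definition involutive_distribution (D : tangent_distribution) : Prop :=
  forall X Y, smooth_section D X -> smooth_section D Y -> smooth_section D (bracket X Y).

(* f is an injective immersion of the r-dimensional manifold N, and D is the
   image of its differential at each point. *)
Definition integral_manifold (D : tangent_distribution) (r : nat)
    (N : topologicalType) (B : atlas R N r) (f : N -> T) : Prop :=
  [/\ smooth_manifold B, injective f, smooth_map B A f,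
      forall y (w : idx B -> 'rV[R]_r), tangent_at y w ->
        differential (B := A) f y w (fun=> 0) -> forall j, dom B j y -> w j = 0 &
      forall y v, D (f y) v <->
        exists2 w : idx B -> 'rV[R]_r, tangent_at y w & differential f y w v].

Definition integrable_distribution (r : nat) (D : tangent_distribution) : Prop :=
  forall z, space A z ->
    exists (N : topologicalType) (B : atlas R N r) (f : N -> T) (y : N),
      integral_manifold D B f /\ f y = z.

(* A foliated atlas of codimension q: the first q coordinates are transverse
   (locally constant on the leaves), the other ones run along the leaves. *)
Definition foliation (q : nat) (F : atlas R T m) : Prop :=
  [/\ forall i, {in dom F i &, injective (crd F i)},
      smooth_map A F id, smooth_map F A id &
      forall i j z, dom F i z -> dom F j z ->
        exists2 O, nbhs (crd F i z) O &
          O `<=` crd F i @` (dom F i `&` dom F j) /\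
          forall u v, O u -> O v ->
            (forall k : 'I_m, (k < q)%N -> u 0 k = v 0 k) ->
            forall k : 'I_m, (k < q)%N ->
              loc i (crd F j) u 0 k = loc i (crd F j) v 0 k].

Definition tangent_to_leaves (q : nat) (F : atlas R T m) : tangent_distribution :=
  fun z => [set v | tangent_at z v /\
    exists2 w : idx F -> 'rV[R]_m, differential id z v w &
      forall j, dom F j z -> forall k : 'I_m, (k < q)%N -> w j 0 k = 0].

(* The distribution D is tangent to a foliation of codimension q. *)
Definition defines_foliation (q : nat) (D : tangent_distribution) : Prop :=
  exists2 F, foliation q F &
    forall z, space A z -> D z = tangent_to_leaves q F z.

End Distributions.

Section CotangentBundle.
Context {R : realType} {M : Type} {n : nat} (A : atlas R M n).

(* The covariant transformation law p_a = (dx'^b / dx^a) p'_b; components in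
   charts away from the base point are normalized to 0, so that equal covectors
   are equal families. *)
Definition is_covector (x : M) (p : idx A -> 'rV[R]_n) : Prop :=
  (forall i, ~ dom A i x -> p i = 0) /\
  forall i j, dom A i x -> dom A j x -> forall a : 'I_n,
    p i 0 a = \sum_b
      ('D_(delta_mx 0 a) (loc i (crd A j)) (crd A i x)) 0 b * p j 0 b.

Record cotangent := Cotangent {
  base : M;
  covec : idx A -> 'rV[R]_n;
  covecP : is_covector base covec }.

Fact cot_scale_subproof (l : R) (z : cotangent) :
  is_covector (base z) (fun i => l *: covec z i).
Proof.
case: z => x p [p0 pT] /=; split=> [i /p0 ->|i j ix jx a]; first by rewrite scaler0.
rewrite mxE (pT _ _ ix jx) mulr_sumr; apply: eq_bigr => b _.
by rewrite mxE mulrCA.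
Qed.

Definition cot_scale (l : R) (z : cotangent) : cotangent :=
  Cotangent (cot_scale_subproof l z).

(* T*M_0: the charts (x^i, p_i) restricted to the nonzero covectors. *)
Definition cot0 : atlas R cotangent (n + n) := {|
  idx := idx A;
  dom := fun i => [set z | dom A i (base z) /\ covec z <> (fun=> 0)];
  crd := fun i z => row_mx (crd A i (base z)) (covec z i) |}.

End CotangentBundle.

Section CartanLocal.
Context {R : realType} {n : nat}.
Variable k : 'rV[R]_(n + n) -> R.
Implicit Types (u v w : 'rV[R]_(n + n)) (f : 'rV[R]_(n + n) -> R).

Definition ddx (i : 'I_n) f : 'rV[R]_(n + n) -> R := 'D_(row_mx (delta_mx 0 i) 0) f.
Definition ddp (i : 'I_n) f : 'rV[R]_(n + n) -> R := 'D_(row_mx 0 (delta_mx 0 i)) f.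

Definition g_up u : 'M[R]_n :=
  \matrix_(i, j) (2^-1 * ddp i (ddp j (fun u' => k u' ^+ 2)) u).

Definition g_dn u : 'M[R]_n := invmx (g_up u).

Definition p_up u (i : 'I_n) : R := 2^-1 * ddp i (fun u' => k u' ^+ 2) u.

(* gamma^i_{jl} *)
Definition gam u (i j l : 'I_n) : R :=
  2^-1 * \sum_s g_up u i s *
    (ddx l (fun u' => g_dn u' j s) u + ddx j (fun u' => g_dn u' s l) u
     - ddx s (fun u' => g_dn u' j l) u).

(* gamma^0_{jl} *)
Definition gam0 u (j l : 'I_n) : R := \sum_i gam u i j l * rsubmx u 0 i.

(* gamma^0_{j0} *)
Definition gam00 u (j : 'I_n) : R := \sum_l gam0 u j l * p_up u l.

Definition N_coef u (i j : 'I_n) : R :=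
  gam0 u i j - 2^-1 * \sum_h gam00 u h * ddp h (fun u' => g_dn u' i j) u.

Definition delta_p u (i : 'I_n) v : R :=
  rsubmx v 0 i - \sum_j N_coef u j i * lsubmx v 0 j.

Definition G_loc u v w : R :=
  \sum_i \sum_j g_dn u i j * lsubmx v 0 i * lsubmx w 0 j +
  \sum_i \sum_j g_up u i j * delta_p u i v * delta_p u j w.

End CartanLocal.

Section CartanSpace.
Context {R : realType} {M : Type} {n : nat} {A : atlas R M n}.
Variable K : cotangent A -> R.

Definition cartan_structure : Prop :=
  [/\ forall z, 0 <= K z,
      forall i, smooth_on (crd (cot0 A) i @` dom (cot0 A) i) (@loc _ _ _ (cot0 A) _ i K),
      forall l z, 0 < l -> K (cot_scale l z) = l * K z &
      forall i z, dom (cot0 A) i z -> forall v : 'rV[R]_n, v != 0 ->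
        0 < (v *m g_up (@loc _ _ _ (cot0 A) _ i K) (crd (cot0 A) i z) *m v^T) 0 0].

(* G_z(v, w), computed in any of the induced charts around z. *)
Definition G_metric (z : cotangent A) (v w : idx (cot0 A) -> 'rV[R]_(n + n)) : R :=
  xget 0 [set G_loc (@loc _ _ _ (cot0 A) _ i K) (crd (cot0 A) i z) (v i) (w i)
         | i in [set i | dom (cot0 A) i z]].

Definition vertical : tangent_distribution (cot0 A) := fun z =>
  [set v | tangent_at z v /\ differential (B := A) (@base _ _ _ A) z v (fun=> 0)].

(* C^* = p_i d/dp_i *)
Definition liouville (z : cotangent A) (i : idx (cot0 A)) : 'rV[R]_(n + n) :=
  row_mx 0 (covec z i).

Definition liouville_line : tangent_distribution (cot0 A) := fun z =>
  [set w | exists a : R, forall i, dom (cot0 A) i z -> w i = a *: liouville z i].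

Definition V_Cstar : tangent_distribution (cot0 A) := fun z =>
  [set v | vertical z v /\ forall w, liouville_line z w -> G_metric z v w = 0].

End CartanSpace.

(* Main.v *)
(* By Euler's identity for the homogeneous function K^2, a vertical vector v satisfies
   G(C*, v) = g^{ij} v_i p_j = D_v(K^2) / 2 = K dK(v), so V_{C*} consists of the vertical
   vectors that kill dK: its leaves are the level sets of K inside the fibres.
   Involutivity follows from [X, Y]f = X(Yf) - Y(Xf), applied to K, to the base coordinates
   and to the transition maps.
   No implicit function theorem is needed for the leaves.  Given an invertible matrix Q, put
   q = pQ; on the half space q_0 > 0 the map (x, p) |-> (x, K(x, p), q_b / q_0) is a chart,
   because the point of the ray through (1, y) Q^-1 at which K = r is explicit by
   homogeneity.  Its first n + 1 coordinates are constant on the leaves, and freezing them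
   parametrizes a leaf by the whole of R^(n-1).  For n = 0 the space T*M_0 is empty. *)
Require Import Defs.
From HB Require Import structures.
From mathcomp Require Import all_boot all_order all_algebra.
From mathcomp Require Import all_classical all_reals all_analysis.
From mathcomp Require Import ring lra.

Set Implicit Arguments.
Unset Strict Implicit.
Unset Printing Implicit Defensive.

Import Order.TTheory GRing.Theory Num.Theory.
Import numFieldNormedType.Exports.

Local Open Scope classical_set_scope.
Local Open Scope ring_scope.

(** * Calculus on open subsets of R^m *)

(** Orthogonality to C^* only yields K dK(v) = 0, and the inverse of the polar chart divides by K,
    so K has to be nonzero off the zero section. The axioms only state 0 <= K; positivity comes from
    positive definiteness, since Euler's identity used twice turns g^{ij} p_i p_j into K^2. Along a
    ray K has degree 1 and the ratios q_b / q_0 have degree 0, so together they play the roles of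
    radius and direction. A single half space misses part of the fibre, hence Q varies with the
    point. The transverse coordinates x and K do not involve Q, and a change of base chart acts on x
    alone; this is why changes of polar charts respect the leaves. Integrability is not deduced from
    involutivity: the leaves are written down, and one slice of a polar chart through each point is
    enough. A constraint recurs everywhere: [loc] is extended by 0 off the chart image, so local
    expressions are compared only near a point, and every chart image must be known to be open. *)

Section Lines.
Context {R : realType} {V : normedModType R}.
Implicit Types (f : V -> R) (x v : V).

(** The two difference quotients are the same function of the increment, so one-variable theorems
    apply along lines. *)
Lemma is_derive_line f x v (s : R) : derivable f (x + s *: v) v ->
  is_derive s (1 : R) (fun t : R => f (x + t *: v)) ('D_v f (x + s *: v)).
Proof.
have E : (fun h : R => h^-1 *: (((fun t : R => f (x + t *: v)) \o shift s) (h *: 1)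
    - f (x + s *: v))) =
  (fun h : R => h^-1 *: ((f \o shift (x + s *: v)) (h *: v) - f (x + s *: v))).
  apply/funext => h /=; congr (_ *: (f _ - _)).
  by rewrite scaler1 scalerDl addrCA.
move=> df; apply: DeriveDef; first by rewrite /derivable E.
by rewrite /derive E.
Qed.

(** Since [h] may be negative, a bound on [|s|] replaces an interval with ordered ends, and the
    proof splits on the sign. *)
Lemma MVT_line f x v (h : R) :
  (forall s, `|s| <= `|h| -> derivable f (x + s *: v) v) ->
  exists2 s, `|s| <= `|h| & f (x + h *: v) - f x = h * 'D_v f (x + s *: v).
Proof.
move=> df; pose g (t : R) := f (x + t *: v).
pose dfl (s : R) := 'D_v f (x + s *: v).
have dg (s : R) : `|s| <= `|h| -> is_derive s (1 : R) g ('D_v f (x + s *: v)).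
  by move=> /df; exact: is_derive_line.
have cont a b : (forall s, s \in `[a, b]%R -> `|s| <= `|h|) ->
    {within `[a, b], continuous g}.
  move=> ab; apply: derivable_within_continuous => s /ab /dg dgs.
  exact: ex_derive.
have g0 : f x = g 0 by rewrite /g scale0r addr0.
have [h0|h0] := leP 0 h.
  have le s : s \in `[0, h]%R -> `|s| <= `|h|.
    by rewrite in_itv /= => /andP[s0 sh]; rewrite !ger0_norm.
  have [|s /le sle eq] := @MVT_segment _ g dfl _ _ h0 _ (cont 0 h le).
    by move=> s ss; apply/dg/le; apply: subset_itv_oo_cc ss.
  exists s => //; rewrite g0 -[f (x + _)]/(g h) eq subr0; exact: mulrC.
have le s : s \in `[h, 0]%R -> `|s| <= `|h|.
  rewrite in_itv /= => /andP[sh s0].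
  by rewrite !ler0_norm ?lerN2// ltW.
have [|s /le sle eq] := @MVT_segment _ g dfl _ _ (ltW h0) _ (cont h 0 le).
  by move=> s ss; apply/dg/le; apply: subset_itv_oo_cc ss.
exists s => //; rewrite g0 -[f (x + _)]/(g h) -opprB eq sub0r mulrN opprK.
exact: mulrC.
Qed.

End Lines.

Section LinearForm.
Context {R : realType} {m : nat}.

(** With the partial derivatives at a point as [c], this is the candidate differential there. *)
Definition linform (c : 'I_m -> R) (h : 'rV[R]_m) : R := \sum_a h 0 a * c a.

Fact linform_is_linear c : linear (linform c).
Proof.
move=> k u v; rewrite /linform scaler_sumr -big_split; apply: eq_bigr => a _ /=.
by rewrite !mxE mulrDl -mulrA.
Qed.

HB.instance Definition _ c :=
  GRing.isLinear.Build R 'rV[R]_m R _ (linform c) (linform_is_linear c).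

Lemma continuous_linform c : continuous (linform c).
Proof.
move=> u; apply: differentiable_continuous.
have -> : linform c = \sum_a ((fun h : 'rV[R]_m => h 0 a) * cst (c a)).
  by apply/funext => h; rewrite fct_sumE.
apply: differentiable_sum => a; apply: differentiableM => //.
exact: differentiable_coord.
Qed.

Lemma norm_coord_le (u : 'rV[R]_m) a : `|u 0 a| <= `|u|.
Proof. by rewrite [leRHS]/Num.Def.normr/= mx_normrE (le_bigmax _ _ (0, a)). Qed.

Lemma norm_row_le (u : 'rV[R]_m) (e : R) : 0 <= e ->
  (forall a, `|u 0 a| <= e) -> `|u| <= e.
Proof.
move=> e0 ue; rewrite /Num.Def.normr/= mx_normrE.
by apply: bigmax_le => // -[i a] _ /=; rewrite ord1.
Qed.

Lemma norm_delta_le (a : 'I_m) : `|delta_mx 0 a : 'rV[R]_m| <= 1.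
Proof.
apply: norm_row_le => // b; rewrite mxE.
by case: andP => _; rewrite ?normr1 ?normr0.
Qed.

End LinearForm.

(** * Continuous partial derivatives imply differentiability *)

Section C1.
Context {R : realType} {m : nat}.
Implicit Types (f : 'rV[R]_m -> R) (u v : 'rV[R]_m) (U : set 'rV[R]_m).
Local Notation E a := (delta_mx 0 a : 'rV[R]_m).

(* u + trunc k h, for k <= m, is a path of coordinate steps from u to u + h. *)
Let trunc k (h : 'rV[R]_m) : 'rV[R]_m := \row_j (if (j < k)%N then h 0 j else 0).

Let trunc0 h : trunc 0 h = 0.
Proof. by apply/rowP => j; rewrite !mxE. Qed.

Let truncm h : trunc m h = h.
Proof. by apply/rowP => j; rewrite !mxE ltn_ord. Qed.

Let truncS h (a : 'I_m) : trunc a.+1 h = trunc a h + h 0 a *: E a.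
Proof.
apply/rowP => j; rewrite !mxE ltnS leq_eqVlt eqxx /=.
have [->|/negbTE ja] := eqVneq j a; first by rewrite eqxx ltnn /= mulr1 add0r.
by rewrite -(inj_eq val_inj) /= in ja; rewrite ja mulr0 addr0.
Qed.

(** The norm is the maximum norm, so the intermediate points of the path stay in the ball on which
    the partial derivatives are controlled. *)
Let trunc_near (h : 'rV[R]_m) (a : 'I_m) (s : R) : `|s| <= `|h 0 a| ->
  `|trunc a h + s *: E a| <= `|h|.
Proof.
move=> sh; apply: norm_row_le => // j; rewrite !mxE eqxx /=.
have [->|ja] := eqVneq j a.
  by rewrite ltnn add0r mulr1 (le_trans sh)// norm_coord_le.
rewrite mulr0 addr0; case: ifP => _; last by rewrite normr0.
exact: norm_coord_le.
Qed.

(** The increment telescopes over coordinate steps; on each step the mean value theorem gives a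
    partial derivative at a nearby point, which continuity compares with the one at [u]. *)
Lemma Ck1_differentiable U f : open U -> Ck 1 U f ->
  forall u, U u -> differentiable f u.
Proof.
move=> oU [_ dU] u Uu.
pose c a := 'D_(E a) f u.
have eqf : f \o shift u = cst (f u) + linform c +o_ (nbhs (0 : 'rV[R]_m)) id.
  apply/eqaddoP => e e0.
  (* The [m] coordinate errors add up to at most [e]; [m.+1] keeps the denominator nonzero when
     [m = 0]. *)
  have e'0 : 0 < e / m.+1%:R by rewrite divr_gt0.
  have near_c (a : 'I_m) : \forall w \near u, `|c a - 'D_(E a) f w| <= e / m.+1%:R.
    have [_ [+ _]] := dU a => /(_ u Uu) /cvgrPdist_le.
    by move=> /(_ _ e'0).
  have : \forall w \near u, U w /\
      forall a : 'I_m, `|c a - 'D_(E a) f w| <= e / m.+1%:R.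
    apply: filterI; first exact: open_nbhs_nbhs.
    exact: (@filter_forall _ _
      (fun a w => `|c a - 'D_(E a) f w| <= e / m.+1%:R) (nbhs u) _ near_c).
  move=> /nbhs_ballP[r /= r0 rball].
  apply/nbhs_ballP; exists r => //= h; rewrite -ball_normE /ball_ /= sub0r normrN => hr.
  have inball w : `|w| <= `|h| -> ball u r (u + w).
    move=> wh; rewrite -ball_normE /ball_ /= opprD addNKr normrN.
    exact: le_lt_trans hr.
  have step (a : 'I_m) : exists2 d, `|c a - d| <= e / m.+1%:R &
      f (u + trunc a.+1 h) - f (u + trunc a h) = h 0 a * d.
    have [s sh|s sh eqs] := @MVT_line _ _ f (u + trunc a h) (E a) (h 0 a).
      rewrite -addrA; apply: (dU a).1.
      by have [] := rball _ (inball _ (trunc_near sh)).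
    exists ('D_(E a) f (u + trunc a h + s *: E a)).
      rewrite -addrA; have [_] := rball _ (inball _ (trunc_near sh)); exact.
    by rewrite -eqs truncS addrA.
  have tele : f (h + u) - f u = \sum_(a < m) (f (u + trunc a.+1 h) - f (u + trunc a h)).
    rewrite -(big_mkord xpredT (fun a => f (u + trunc a.+1 h) - f (u + trunc a h))).
    by rewrite telescope_sumr// trunc0 truncm addr0 [h + u]addrC.
  have -> : (f \o shift u - (cst (f u) + linform c)) h =
      f (h + u) - f u - linform c h.
    by rewrite -![(_ - _ : _ -> _) _]/(_ - _) -![(_ + _ : _ -> _) _]/(_ + _) opprD addrA.
  rewrite tele /linform -sumrB.
  apply: (le_trans (ler_norm_sum _ _ _)).
  apply: (@le_trans _ _ (\sum_(a < m) (e / m.+1%:R * `|h|))).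
    apply: ler_sum => a _; have [d cd ->] := step a.
    rewrite -mulrBr normrM mulrC distrC; apply: ler_pM => //.
    exact: norm_coord_le.
  rewrite sumr_const card_ord -[_ *+ m]mulr_natl mulrA; apply: ler_wpM2r => //.
  by rewrite mulrCA ger_pMr// ler_pdivrMr// mul1r ler_nat.
(* ['d f u] is a chosen value; uniqueness identifies it with [linform c] and so carries the
   expansion [eqf] over to it. *)
have dfE : 'd f u = linform c :> ('rV[R]_m -> R).
  exact: (@diff_unique _ _ _ f (linform c) u (@continuous_linform _ _ c) eqf).
by apply/diff_locallyP; rewrite dfE; split => //; exact: continuous_linform.
Qed.

End C1.

Section Derivatives.
Context {R : realType}.

Lemma derive_comp (U V W : normedModType R) (f : U -> V) (g : V -> W) u v :
  differentiable f u -> differentiable g (f u) ->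
  'D_v (g \o f) u = 'D_('D_v f u) g (f u).
Proof.
move=> df dg; rewrite (deriveE _ (differentiable_comp df dg)) diff_comp//.
by rewrite (deriveE v df) (deriveE _ dg).
Qed.

Lemma derive_lincomb m (W : normedModType R) (f : 'rV[R]_m -> W) u v :
  differentiable f u ->
  'D_v f u = \sum_a v 0 a *: 'D_(delta_mx 0 a) f u.
Proof.
move=> df; rewrite (deriveE v df) {1}[v]row_sum_delta linear_sum.
by apply: eq_bigr => a _; rewrite linearZ (deriveE _ df).
Qed.

Lemma differentiable_row (V : normedModType R) n (F : V -> 'rV[R]_n) u :
  (forall j, differentiable (fun u => F u 0 j) u) -> differentiable F u.
Proof.
move=> dF; have -> : F = \sum_j (fun u => F u 0 j *: (delta_mx 0 j : 'rV[R]_n)).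
  by apply/funext => w; rewrite fct_sumE -row_sum_delta.
by apply: differentiable_sum => j; exact: differentiableZl.
Qed.

Lemma differentiable_entry (V : normedModType R) n (F : V -> 'rV[R]_n) u j :
  differentiable F u -> differentiable (fun u => F u 0 j) u.
Proof.
move=> dF; apply: (@differentiable_comp _ _ _ _ F (fun M : 'rV[R]_n => M 0 j)) => //.
exact: differentiable_coord.
Qed.

Lemma derive_row (V : normedModType R) n (F : V -> 'rV[R]_n) u v j :
  differentiable F u -> ('D_v F u) 0 j = 'D_v (fun u => F u 0 j) u.
Proof. by move=> dF; rewrite derive_mx ?mxE//; exact: diff_derivable. Qed.

Lemma derive_linear (V W : normedModType R) (f : {linear V -> W}) u v :
  continuous f -> 'D_v f u = f v.
Proof.
by move=> cf; rewrite (deriveE v (linear_differentiable u cf)) diff_lin.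
Qed.

End Derivatives.

(** * Stability properties of C^k functions *)

Section CkGeneral.
Context {R : realType} {m : nat} {W : normedModType R}.
Implicit Types (f g : 'rV[R]_m -> W) (U V : set 'rV[R]_m).

Lemma Ck_continuous k U f : Ck k U f ->
  forall u, U u -> {for u, continuous f}.
Proof. by case: k => [|k] []. Qed.

Lemma CkW k U f : Ck k.+1 U f -> Ck k U f.
Proof.
elim: k f => [|k IH] f [cf df]; split => // a.
have [dfa /IH ?] := df a; by split.
Qed.

Lemma Ck_le k k' U f : (k <= k')%N -> Ck k' U f -> Ck k U f.
Proof.
move=> /subnK <-; elim: (k' - k)%N => // i IH; rewrite addSn => /CkW; exact: IH.
Qed.

(** [Ck] speaks of full-space derivatives at the points of its set, so any set containing the point
    may serve as [V], open or not. *)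
Lemma Ck_local k U f :
  (forall u, U u -> exists2 V, V u & Ck k V f) -> Ck k U f.
Proof.
elim: k f => [|k IH] f locf; split.
- by move=> u /locf[V Vu [+ _]]; exact.
- by [].
- by move=> u /locf[V Vu [+ _]]; exact.
- move=> a; split.
    by move=> u /locf[V Vu [_ /(_ a)[+ _]]]; exact.
  by apply: IH => u /locf[V Vu [_ /(_ a)[_ ?]]]; exists V.
Qed.

Lemma Ck_subset k U V f : U `<=` V -> Ck k V f -> Ck k U f.
Proof. by move=> UV fV; apply: Ck_local => u /UV Vu; exists V. Qed.

(** Openness turns equality on [U] into equality near each point, which the derivatives inherit. *)
Lemma Ck_ext k U f g : open U -> (forall u, U u -> f u = g u) ->
  Ck k U f -> Ck k U g.
Proof.
move=> oU; have near_fg (f' g' : 'rV[R]_m -> W) u : (forall w, U w -> f' w = g' w) ->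
    U u -> {near u, f' =1 g'}.
  move=> fg Uu; apply: filterS (open_nbhs_nbhs (conj oU Uu)).
  by move=> w /fg.
have near_cont (f' g' : 'rV[R]_m -> W) : (forall w, U w -> f' w = g' w) ->
    (forall u, U u -> {for u, continuous f'}) ->
    forall u, U u -> {for u, continuous g'}.
  move=> fg cf u Uu; rewrite /prop_for /continuous_at -(fg _ Uu).
  exact: cvg_trans (near_eq_cvg (near_fg _ _ _ fg Uu)) (cf u Uu).
elim: k f g => [|k IH] f g fg [cf df].
  by split => //; exact: near_cont cf.
split.
  exact: near_cont cf.
move=> a; have [dfa Cfa] := df a; split.
  by move=> u Uu; apply: (near_eq_derivable (near_fg _ _ _ fg Uu)); exact: dfa.
apply: IH Cfa => u Uu; apply: near_eq_derive.
exact: (near_fg _ _ _ fg).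
Qed.

Lemma Ck_cst k U (c : W) : Ck k U (cst c).
Proof.
elim: k c => [|k IH] c; split => //.
- by move=> u _; exact: cst_continuous.
- by move=> u _; exact: cst_continuous.
- move=> a; split; first by move=> u _; exact: derivable_cst.
  have -> : 'D_(delta_mx 0 a) (cst c : 'rV[R]_m -> W) = cst 0.
    by apply/funext => u; rewrite derive_cst.
  exact: IH.
Qed.

Lemma Ck_add k U f g : open U -> Ck k U f -> Ck k U g -> Ck k U (f + g).
Proof.
move=> oU; elim: k f g => [|k IH] f g [cf df] [cg dg]; split => //.
- by move=> u Uu; apply: continuousD; [exact: cf|exact: cg].
- by move=> u Uu; apply: continuousD; [exact: cf|exact: cg].
- move=> a; have [dfa Cfa] := df a; have [dga Cga] := dg a; split.
    by move=> u Uu; apply: derivableD; [exact: dfa|exact: dga].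
  apply: Ck_ext (IH _ _ Cfa Cga) => // u Uu.
  by rewrite deriveD//; [exact: dfa|exact: dga].
Qed.

Lemma Ck_sum k U (I : Type) (r : seq I) (F : I -> 'rV[R]_m -> W) : open U ->
  (forall i, Ck k U (F i)) -> Ck k U (\sum_(i <- r) F i).
Proof.
move=> oU CF; elim: r => [|i r IH]; first by rewrite big_nil; exact: Ck_cst.
by rewrite big_cons; exact: Ck_add.
Qed.

End CkGeneral.

Section CkScalar.
Context {R : realType} {m : nat}.
Implicit Types (f g : 'rV[R]_m -> R) (U : set 'rV[R]_m).

Lemma Ck_mul k U f g : open U -> Ck k U f -> Ck k U g -> Ck k U (f * g).
Proof.
move=> oU; elim: k f g => [|k IH] f g Cf Cg.
  case: Cf Cg => cf _ [cg _]; split => // u Uu.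
  by apply: continuousM; [exact: cf|exact: cg].
case: (Cf) (Cg) => cf df [cg dg]; split.
  by move=> u Uu; apply: continuousM; [exact: cf|exact: cg].
move=> a; have [dfa Cfa] := df a; have [dga Cga] := dg a; split.
  by move=> u Uu; apply: derivableM; [exact: dfa|exact: dga].
apply: (@Ck_ext _ _ _ _ _
  (f * 'D_(delta_mx 0 a) g + g * 'D_(delta_mx 0 a) f)) => //.
  by move=> u Uu; rewrite deriveM//; [exact: dfa|exact: dga].
by apply: Ck_add => //; apply: IH => //; exact: CkW.
Qed.

(** The partial derivative -f^-2 D_a f involves 1/f only at the lower order, which closes the
    induction. *)
Lemma Ck_inv k U f : open U -> (forall u, U u -> f u != 0) ->
  Ck k U f -> Ck k U (fun u => (f u)^-1).
Proof.
move=> oU f0; elim: k f f0 => [|k IH] f f0 Cf.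
  by case: Cf => cf _; split => // u Uu; apply: continuousV; [exact: f0|exact: cf].
case: (Cf) => cf df; split.
  by move=> u Uu; apply: continuousV; [exact: f0|exact: cf].
move=> a; have [dfa Cfa] := df a; split.
  by move=> u Uu; apply: derivableV; [exact: f0|exact: dfa].
apply: (@Ck_ext _ _ _ _ _
  (cst (-1) * ((fun u => (f u)^-1) * (fun u => (f u)^-1) * 'D_(delta_mx 0 a) f))) => //.
  move=> u Uu; rewrite deriveV//; [|exact: f0|exact: dfa].
  by rewrite -[LHS]/(-1 * ((f u)^-1 * (f u)^-1 * _)) mulN1r -expr2 -exprVn -mulNr.
have Ci := IH _ f0 (CkW Cf).
by apply: Ck_mul => //; [exact: Ck_cst|do 2 apply: Ck_mul => //].
Qed.

Lemma Ck_coord k U (a : 'I_m) : Ck k U (fun u => u 0 a).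
Proof.
case: k => [|k]; split => //.
- by move=> u _; exact: coord_continuous.
- by move=> u _; exact: coord_continuous.
move=> b; split.
  by move=> u _; apply: diff_derivable; exact: differentiable_coord.
have -> : 'D_(delta_mx 0 b) (fun u : 'rV[R]_m => u 0 a) = cst ((b == a)%:R : R).
  apply/funext => u; rewrite -(derive_row _ _ (F := id))//.
  by rewrite derive_id mxE eqxx eq_sym.
exact: Ck_cst.
Qed.

End CkScalar.

Section CkVector.
Context {R : realType}.

Lemma Ck_row m n k (U : set 'rV[R]_m) (F : 'rV[R]_m -> 'rV[R]_n) : open U ->
  Ck k U F <-> forall j, Ck k U (fun u => F u 0 j).
Proof.
move=> oU; elim: k F => [|k IH] F; split.
- move=> [cF _] j; split => // u /cF cFu.
  exact: (continuous_comp cFu (@coord_continuous _ _ _ 0 j _)).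
- move=> CF; split; last by [].
  move=> u Uu; apply: (cvgrPdist_le (F := nbhs u) _ _).2 => e e0.
  have cF (j : 'I_n) : \forall w \near u, `|F u 0 j - F w 0 j| <= e.
    by have [+ _] := CF j => /(_ u Uu)/cvgrPdist_le; exact.
  have cFa := @filter_forall _ _ (fun j w => `|F u 0 j - F w 0 j| <= e) (nbhs u) _ cF.
  near=> w; apply: norm_row_le; first exact: ltW.
  by move=> j; rewrite !mxE; move: j; near: w; exact: cFa.
- move=> [cF dF] j; split.
    move=> u /cF cFu.
    exact: (continuous_comp cFu (@coord_continuous _ _ _ 0 j _)).
  move=> a; have [dFa CFa] := dF a; split.
    by move=> u /dFa/derivable_mxP; exact.
  have := (IH _).1 CFa j; apply: Ck_ext => // u Uu.
  by rewrite derive_mx ?mxE//; exact: dFa.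
- move=> CF.
  have dF a u : U u -> derivable F u (delta_mx 0 a).
    move=> Uu; apply/derivable_mxP => i j; rewrite ord1.
    by have [_ /(_ a)[+ _]] := CF j; exact.
  split.
    exact: Ck_continuous ((IH F).2 (fun j => CkW (CF j))).
  move=> a; split; first exact: dF.
  apply/IH => j; have [_ /(_ a)[_]] := CF j; apply: Ck_ext => // u Uu.
  by rewrite derive_mx ?mxE//; exact: dF.
Unshelve. all: by end_near. Qed.

Lemma Ck1_differentiable_row m n k (U : set 'rV[R]_m) (F : 'rV[R]_m -> 'rV[R]_n) :
  open U -> Ck k.+1 U F -> forall u, U u -> differentiable F u.
Proof.
move=> oU CF u Uu; apply: differentiable_row => j.
apply: (Ck1_differentiable oU) => //; apply: (@Ck_le _ _ _ _ k.+1) => //.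
exact: (Ck_row _ _ oU).1.
Qed.

(** Each partial derivative is a sum of products of D_a G_b and (D_b f) o G, and the induction
    hypothesis covers the second factor. The chain rule requires full differentiability, supplied by
    [Ck1_differentiable]. *)
Lemma Ck_comp m n k (U : set 'rV[R]_m) (V : set 'rV[R]_n)
    (G : 'rV[R]_m -> 'rV[R]_n) (f : 'rV[R]_n -> R) :
  open U -> open V -> (forall u, U u -> V (G u)) ->
  Ck k U G -> Ck k V f -> Ck k U (f \o G).
Proof.
move=> oU oV UV; elim: k f => [|k IH] f CG Cf.
  case: CG Cf => cG _ [cf _]; split => // u Uu.
  by apply: continuous_comp; [exact: cG|apply/cf/UV].
have dG u : U u -> differentiable G u by exact: Ck1_differentiable_row CG u.
have df v : V v -> differentiable f v.
  by apply: Ck1_differentiable => //; exact: (@Ck_le _ _ _ _ k.+1).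
split.
  move=> u Uu; apply: continuous_comp; first by case: CG => cG _; exact: cG.
  by case: Cf => cf _; apply/cf/UV.
move=> a; split.
  move=> u Uu; apply: diff_derivable; apply: differentiable_comp; first exact: dG.
  by apply/df/UV.
apply: (@Ck_ext _ _ _ _ _ (\sum_b ((fun u => 'D_(delta_mx 0 a) (fun w => G w 0 b) u) *
    ('D_(delta_mx 0 b) f \o G)))) => //.
  move=> u Uu; rewrite derive_comp; [|exact: dG|by apply/df/UV].
  rewrite derive_lincomb; last by apply/df/UV.
  by rewrite fct_sumE; apply: eq_bigr => b _; rewrite derive_row//; exact: dG.
apply: Ck_sum => // b; apply: Ck_mul => //.
  by have [_ /(_ a)[]] := (Ck_row _ _ oU).1 CG b.
by apply: IH; [exact: CkW|have [_ /(_ b)[]] := Cf].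
Qed.

End CkVector.

(** * Symmetry of second derivatives and the Lie bracket *)

Section Schwarz.
Context {R : realType} {m : nat}.
Implicit Types (f : 'rV[R]_m -> R) (u v : 'rV[R]_m) (U : set 'rV[R]_m).
Local Notation E a := (delta_mx 0 a : 'rV[R]_m).

Lemma is_derive_translate f u v c : derivable f (u + c) v ->
  is_derive u v (fun w => f (w + c)) ('D_v f (u + c)).
Proof.
have eqf : (fun h : R => h^-1 *: (((fun w => f (w + c)) \o shift u) (h *: v) -
    f (u + c))) =
  (fun h : R => h^-1 *: ((f \o shift (u + c)) (h *: v) - f (u + c))).
  by apply/funext => h /=; rewrite addrA.
by move=> df; apply: DeriveDef; rewrite /derivable /derive eqf.
Qed.

(** The mean value theorem is used twice: along [E a] for the increment [g], then along [E b] for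
    ['D_(E a) f]. *)
Lemma second_difference f U a b u (s : R) : Ck 2 U f ->
  (forall s1 t1, `|s1| <= `|s| -> `|t1| <= `|s| -> U (u + s1 *: E a + t1 *: E b)) ->
  exists s1 t1, [/\ `|s1| <= `|s|, `|t1| <= `|s| &
    (f (u + s *: E a + s *: E b) - f (u + s *: E a)) -
    (f (u + s *: E b) - f u) =
    s * (s * 'D_(E b) ('D_(E a) f) (u + s1 *: E a + t1 *: E b))].
Proof.
move=> [_ Cf] sq; have [df [_ ddf]] := Cf a.
pose g w := f (w + s *: E b) - f w.
have dg s1 : `|s1| <= `|s| -> is_derive (u + s1 *: E a) (E a) g
    ('D_(E a) f (u + s1 *: E a + s *: E b) - 'D_(E a) f (u + s1 *: E a)).
  move=> s1s; apply: is_deriveB.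
    by apply: is_derive_translate; apply: df; exact: sq.
  apply: derivableP; apply: df.
  by have := sq s1 0 s1s; rewrite scale0r addr0 normr0; exact.
have [s1 s1s|s1 s1s eqs] := @MVT_line _ _ g u (E a) s.
  exact: (@ex_derive _ _ _ _ _ _ _ (dg _ s1s)).
have [t1 t1s|t1 t1s eqt] := @MVT_line _ _ ('D_(E a) f) (u + s1 *: E a) (E b) s.
  by apply: (ddf b).1; exact: sq.
exists s1, t1; split => //.
by rewrite -eqt -(@derive_val _ _ _ _ _ _ _ (dg _ s1s)) -eqs.
Qed.

Let dist_le_half (e x y p q : R) : `|x - p| <= e / 2 -> `|y - q| <= e / 2 ->
  p = q -> `|x - y| <= e.
Proof.
move=> xp yq pq; have -> : x - y = (x - p) - (y - q) by rewrite pq; ring.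
by apply: le_trans (ler_normB _ _) _; rewrite [e]splitr lerD.
Qed.

(** The second difference over a small square is symmetric in [a] and [b], and equals [s * s] times
    either mixed derivative at points near [u], where both are continuous. *)
Lemma schwarz f U a b : open U -> Ck 2 U f -> forall u, U u ->
  'D_(E b) ('D_(E a) f) u = 'D_(E a) ('D_(E b) f) u.
Proof.
move=> oU Cf u Uu.
have cont2 c d : {for u, continuous ('D_(E d) ('D_(E c) f))}.
  have [_ /(_ c)[_ [_ /(_ d)[_ [+ _]]]]] := Cf; exact.
apply/eqP; rewrite -subr_eq0 -normr_le0; apply/ler_addgt0Pr => e e0.
have e2 : 0 < e / 2 by rewrite divr_gt0.
have near2 c d : \forall w \near u,
    `|'D_(E d) ('D_(E c) f) u - 'D_(E d) ('D_(E c) f) w| <= e / 2.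
  by move: (cont2 c d) => /cvgrPdist_le; exact.
have [r /= r0 rball] := (nbhs_ballP u _).1
  (filterI (open_nbhs_nbhs (conj oU Uu)) (filterI (near2 a b) (near2 b a))).
(* Two coordinate steps of length at most r / 4 stay strictly inside the ball of radius r. *)
pose s := r / 4; have s0 : 0 < s by rewrite divr_gt0.
have inball c d s1 t1 : `|s1| <= `|s| -> `|t1| <= `|s| ->
    ball u r (u + s1 *: E c + t1 *: E d).
  move=> s1s t1s; rewrite -ball_normE /ball_ /= -addrA opprD addNKr normrN.
  apply: (le_lt_trans (ler_normD _ _)); rewrite !normrZ.
  apply: (@le_lt_trans _ _ (`|s| + `|s|)).
    by apply: lerD; rewrite -[leRHS]mulr1 ler_pM// norm_delta_le.
  rewrite gtr0_norm// /s; lra.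
have [|s1 [t1 [s1s t1s eqab]]] := @second_difference f U a b u s Cf.
  by move=> s1 t1 s1s t1s; exact: (rball _ (inball a b _ _ s1s t1s)).1.
have [|s2 [t2 [s2s t2s eqba]]] := @second_difference f U b a u s Cf.
  by move=> s2 t2 s2s t2s; exact: (rball _ (inball b a _ _ s2s t2s)).1.
have [_ [ab _]] := rball _ (inball a b _ _ s1s t1s).
have [_ [_ ba]] := rball _ (inball b a _ _ s2s t2s).
have eqD : 'D_(E b) ('D_(E a) f) (u + s1 *: E a + t1 *: E b) =
           'D_(E a) ('D_(E b) f) (u + s2 *: E b + t2 *: E a).
  apply: (mulfI (lt0r_neq0 s0)); apply: (mulfI (lt0r_neq0 s0)).
  have swap (p q r' t : R) : p - q - (r' - t) = p - r' - (q - t) by ring.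
  apply: (etrans (esym eqab)); apply: (etrans _ eqba).
  rewrite (addrAC u (s *: E b)); exact: swap.
rewrite add0r; exact: dist_le_half ab ba eqD.
Qed.

Let addrK2 (x y z : R) : x + z - (y + z) = x - y.
Proof. by rewrite opprD addrACA subrr addr0. Qed.

(** By the product rule, differentiating w |-> D_(Z w) f along v gives D_(D_v Z) f plus the Hessian
    of f on (Z u, v). The Hessian terms of the two orders cancel by [schwarz]. *)
Lemma derive_bracket f U (X Y : 'rV[R]_m -> 'rV[R]_m) : open U ->
  Ck 2 U f -> Ck 1 U X -> Ck 1 U Y -> forall u, U u ->
  'D_('D_(X u) Y u - 'D_(Y u) X u) f u =
  'D_(X u) (fun w => 'D_(Y w) f w) u - 'D_(Y u) (fun w => 'D_(X w) f w) u.
Proof.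
move=> oU Cf CX CY u Uu.
have df w : U w -> differentiable f w.
  by apply: Ck1_differentiable => //; exact: CkW.
have dDf a w : U w -> differentiable ('D_(E a) f) w.
  by apply: Ck1_differentiable => //; case: Cf => _ /(_ a)[].
have dX w : U w -> differentiable X w by exact: Ck1_differentiable_row CX w.
have dY w : U w -> differentiable Y w by exact: Ck1_differentiable_row CY w.
have [S symS step] : exists2 S : 'I_m -> 'I_m -> R, (forall a b, S a b = S b a) &
    forall (Z : 'rV[R]_m -> 'rV[R]_m) v, (forall w, U w -> differentiable Z w) ->
    'D_v (fun w => 'D_(Z w) f w) u =
    'D_('D_v Z u) f u + \sum_a \sum_b Z u 0 a * (v 0 b * S a b).
  exists (fun a b => 'D_(E b) ('D_(E a) f) u).
    by move=> a b; exact: (schwarz _ _ oU Cf Uu).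
  move=> Z v dZ.
  pose h := \sum_a ((fun w => Z w 0 a) * 'D_(E a) f).
  have -> : 'D_v (fun w => 'D_(Z w) f w) u = 'D_v h u.
    apply: near_eq_derive; near=> w; rewrite /h fct_sumE derive_lincomb//.
    by apply: df; near: w; exact: open_nbhs_nbhs.
  have dZa a : derivable (fun w => Z w 0 a) u v.
    by apply: diff_derivable; apply: differentiable_entry; exact: dZ.
  have dfa a : derivable ('D_(E a) f) u v by apply: diff_derivable; exact: dDf.
  rewrite /h derive_sum; last by move=> a; exact: derivableM.
  rewrite (derive_lincomb _ (df u Uu)) -big_split; apply: eq_bigr => a _ /=.
  rewrite deriveM// [RHS]addrC derive_row; last exact: dZ.
  congr (_ + _); last exact: mulrC.
  by rewrite (derive_lincomb _ (dDf a u Uu)) scaler_sumr.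
rewrite !step// [X in _ = _ + X - _]exchange_big /=.
under eq_bigr do under eq_bigr do rewrite mulrCA symS.
apply: (etrans _ (esym (addrK2 _ _ _))).
by rewrite !(deriveE _ (df u Uu)); exact: linearB.
Unshelve. all: by end_near. Qed.

End Schwarz.

Section Smooth.
Context {R : realType} {m : nat}.
Implicit Types (f g : 'rV[R]_m -> R) (U : set 'rV[R]_m).

Lemma smooth_continuous (W : normedModType R) U (f : 'rV[R]_m -> W) :
  smooth_on U f -> forall u, U u -> {for u, continuous f}.
Proof. by move=> sf; exact: Ck_continuous (sf 0). Qed.

Lemma smooth_local (W : normedModType R) U (f : 'rV[R]_m -> W) :
  (forall u, U u -> exists2 V, V u & smooth_on V f) -> smooth_on U f.
Proof.
by move=> sf k; apply: Ck_local => u /sf[V Vu sV]; exists V.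
Qed.

Lemma smooth_subset (W : normedModType R) U V (f : 'rV[R]_m -> W) :
  U `<=` V -> smooth_on V f -> smooth_on U f.
Proof. by move=> UV sf k; exact: Ck_subset (sf k). Qed.

Lemma smooth_ext (W : normedModType R) U (f g : 'rV[R]_m -> W) : open U ->
  (forall u, U u -> f u = g u) -> smooth_on U f -> smooth_on U g.
Proof. by move=> oU fg sf k; exact: Ck_ext (sf k). Qed.

Lemma smooth_cst (W : normedModType R) U (c : W) :
  smooth_on U (fun _ : 'rV[R]_m => c).
Proof. by move=> k; exact: Ck_cst. Qed.

Lemma smooth_derive (W : normedModType R) U (f : 'rV[R]_m -> W) a :
  smooth_on U f -> smooth_on U ('D_(delta_mx 0 a) f).
Proof. by move=> sf k; have [_ /(_ a)[]] := sf k.+1. Qed.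

Lemma smooth_sum (W : normedModType R) U (I : finType)
    (F : I -> 'rV[R]_m -> W) : open U ->
  (forall i, smooth_on U (F i)) -> smooth_on U (fun u => \sum_i F i u).
Proof.
move=> oU sF k; have -> : (fun u => \sum_i F i u) = \sum_i F i.
  by apply/funext => u; rewrite fct_sumE.
by apply: Ck_sum => // i; exact: sF.
Qed.

Lemma smooth_mul U f g : open U ->
  smooth_on U f -> smooth_on U g -> smooth_on U (fun u => f u * g u).
Proof. by move=> oU sf sg k; exact: Ck_mul. Qed.

Lemma smooth_inv U f : open U -> (forall u, U u -> f u != 0) ->
  smooth_on U f -> smooth_on U (fun u => (f u)^-1).
Proof. by move=> oU f0 sf k; exact: Ck_inv. Qed.

Lemma smooth_coord U (a : 'I_m) : smooth_on U (fun u : 'rV[R]_m => u 0 a).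
Proof. by move=> k; exact: Ck_coord. Qed.

Lemma smooth_row n U (F : 'rV[R]_m -> 'rV[R]_n) : open U ->
  smooth_on U F <-> forall j, smooth_on U (fun u => F u 0 j).
Proof.
move=> oU; split=> [sF j k|sF k]; last by apply/Ck_row => // j; exact: sF.
exact: (Ck_row _ _ oU).1.
Qed.

Lemma smooth_id U : open U -> smooth_on U (fun u : 'rV[R]_m => u).
Proof. by move=> oU; apply/smooth_row => // j; exact: smooth_coord. Qed.

Lemma smooth_differentiable U f : open U -> smooth_on U f ->
  forall u, U u -> differentiable f u.
Proof. by move=> oU sf; exact: Ck1_differentiable (sf 1). Qed.

Lemma smooth_differentiable_row n U (F : 'rV[R]_m -> 'rV[R]_n) : open U ->
  smooth_on U F -> forall u, U u -> differentiable F u.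
Proof. by move=> oU sF; exact: Ck1_differentiable_row (sF 1). Qed.

Lemma smooth_row_mx n1 n2 U (F : 'rV[R]_m -> 'rV[R]_n1) (G : 'rV[R]_m -> 'rV[R]_n2) :
  open U -> smooth_on U F -> smooth_on U G ->
  smooth_on U (fun u => row_mx (F u) (G u)).
Proof.
move=> oU sF sG; apply/smooth_row => // j; case: (split_ordP j) => i ->.
  rewrite (_ : (fun _ => _) = fun u => F u 0 i); first exact: (smooth_row _ oU).1.
  by apply/funext => u; rewrite row_mxEl.
rewrite (_ : (fun _ => _) = fun u => G u 0 i); first exact: (smooth_row _ oU).1.
by apply/funext => u; rewrite row_mxEr.
Qed.

Lemma smooth_lsubmx n1 n2 U (F : 'rV[R]_m -> 'rV[R]_(n1 + n2)) :
  open U -> smooth_on U F -> smooth_on U (fun u => lsubmx (F u)).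
Proof.
move=> oU sF; apply/smooth_row => // j.
rewrite (_ : (fun _ => _) = fun u => F u 0 (lshift n2 j)).
  exact: (smooth_row _ oU).1.
by apply/funext => u; rewrite mxE.
Qed.

Lemma smooth_rsubmx n1 n2 U (F : 'rV[R]_m -> 'rV[R]_(n1 + n2)) :
  open U -> smooth_on U F -> smooth_on U (fun u => rsubmx (F u)).
Proof.
move=> oU sF; apply/smooth_row => // j.
rewrite (_ : (fun _ => _) = fun u => F u 0 (rshift n1 j)).
  exact: (smooth_row _ oU).1.
by apply/funext => u; rewrite mxE.
Qed.

Lemma smooth_scale n U f (F : 'rV[R]_m -> 'rV[R]_n) : open U ->
  smooth_on U f -> smooth_on U F -> smooth_on U (fun u => f u *: F u).
Proof.
move=> oU sf sF; apply/smooth_row => // j.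
rewrite (_ : (fun _ => _) = fun u => f u * F u 0 j).
  by apply: smooth_mul => //; exact: (smooth_row _ oU).1.
by apply/funext => u; rewrite mxE.
Qed.

Lemma smooth_mulmxr n1 n2 U (F : 'rV[R]_m -> 'rV[R]_n1) (Q : 'M[R]_(n1, n2)) :
  open U -> smooth_on U F -> smooth_on U (fun u => F u *m Q).
Proof.
move=> oU sF; apply/smooth_row => // j.
rewrite (_ : (fun _ => _) = fun u => \sum_i F u 0 i * Q i j).
  apply: smooth_sum => // i; apply: smooth_mul => //; last exact: smooth_cst.
  exact: (smooth_row _ oU).1.
by apply/funext => u; rewrite mxE.
Qed.

End Smooth.

Section SmoothComposition.
Context {R : realType} {m : nat}.
Implicit Types (f g : 'rV[R]_m -> R) (U : set 'rV[R]_m).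

Lemma smooth_comp n U (V : set 'rV[R]_n) (G : 'rV[R]_m -> 'rV[R]_n)
    (f : 'rV[R]_n -> R) :
  open U -> open V -> (forall u, U u -> V (G u)) ->
  smooth_on U G -> smooth_on V f -> smooth_on U (fun u => f (G u)).
Proof. by move=> oU oV UV sG sf k; exact: Ck_comp (sf k). Qed.

Lemma smooth_comp_row n l U (V : set 'rV[R]_n) (G : 'rV[R]_m -> 'rV[R]_n)
    (F : 'rV[R]_n -> 'rV[R]_l) :
  open U -> open V -> (forall u, U u -> V (G u)) ->
  smooth_on U G -> smooth_on V F -> smooth_on U (fun u => F (G u)).
Proof.
move=> oU oV UV sG sF; apply/smooth_row => // j.
apply: (smooth_comp (f := fun w => F w 0 j) oU oV) => //.
exact: (smooth_row _ oV).1.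
Qed.

Lemma smooth_derive_along n U (Y : 'rV[R]_m -> 'rV[R]_m) (F : 'rV[R]_m -> 'rV[R]_n) :
  open U -> smooth_on U Y -> smooth_on U F -> smooth_on U (fun u => 'D_(Y u) F u).
Proof.
move=> oU sY sF.
apply: (@smooth_ext _ _ _ _ (fun u => \sum_a Y u 0 a *: 'D_(delta_mx 0 a) F u)) => //.
  by move=> u Uu; rewrite derive_lincomb//; exact: smooth_differentiable_row sF u Uu.
apply: smooth_sum => // a; apply: smooth_scale => //.
  exact: (smooth_row _ oU).1.
exact: smooth_derive.
Qed.

Lemma smooth_addr n U (F G : 'rV[R]_m -> 'rV[R]_n) : open U ->
  smooth_on U F -> smooth_on U G -> smooth_on U (fun u => F u + G u).
Proof. by move=> oU sF sG k; exact: Ck_add. Qed.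

Lemma open_preimage n U (V : set 'rV[R]_n) (G : 'rV[R]_m -> 'rV[R]_n) :
  open U -> open V -> smooth_on U G -> open (U `&` G @^-1` V).
Proof.
move=> oU oV sG; rewrite openE => u [Uu VGu]; apply: filterI.
  exact: open_nbhs_nbhs.
apply: (smooth_continuous sG Uu); exact: open_nbhs_nbhs.
Qed.

End SmoothComposition.

(** * Charts of manifolds and of the cotangent bundle *)

Section Charts.
Context {R : realType}.

Definition chart_injective (T : Type) (m : nat) (A : atlas R T m) :=
  forall i z z', dom A i z -> dom A i z' -> crd A i z = crd A i z' -> z = z'.

Lemma chart_injectiveP (T : Type) (m : nat) (A : atlas R T m) :
  (forall i, {in dom A i &, injective (crd A i)}) <-> chart_injective A.
Proof.
split=> injA i z z'; first by move=> iz iz'; apply: injA; rewrite in_setE.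
by rewrite !in_setE; exact: injA.
Qed.

(** This is one clause of [smooth_map], isolated because transitions with polar charts are obtained
    pair by pair. *)
Definition smooth_charts (T T' : Type) (m m' : nat) (A : atlas R T m)
    (B : atlas R T' m') (f : T -> T') (i : idx A) (j : idx B) :=
  let U := crd A i @` (dom A i `&` f @^-1` dom B j) in
  open U /\ smooth_on U (loc i (crd B j \o f)).

Arguments smooth_charts {T T' m m'} A B f i j.

Lemma locE (T : Type) (m : nat) (A : atlas R T m) (W : normedModType R)
    i (f : T -> W) z :
  chart_injective A -> dom A i z -> loc i f (crd A i z) = f z.
Proof.
move=> injA iz; rewrite /loc; case: xgetP => [w _ [z' [iz' eqz] <-]|].
  by rewrite (injA _ _ _ iz' iz eqz).
by move=> /(_ (f z)) []; exists z.
Qed.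

Lemma smooth_charts_differentiable (T T' : Type) (m m' : nat) (A : atlas R T m)
    (B : atlas R T' m') (f : T -> T') (i : idx A) (j : idx B) z :
  smooth_charts A B f i j -> dom A i z -> dom B j (f z) ->
  differentiable (loc i (crd B j \o f)) (crd A i z).
Proof.
by move=> [oU sU] iz jz; apply: (smooth_differentiable_row oU sU); exists z.
Qed.

Context {T T' T'' : Type} {m m' m'' : nat}.
Context {A : atlas R T m} {B : atlas R T' m'} {C : atlas R T'' m''}.
Variables (f : T -> T') (g : T' -> T'').

Hypotheses (injA : chart_injective A) (injB : chart_injective B).

(** A point of [W] comes from some z' with f z' in chart [j]; injectivity of the charts of [B]
    identifies f z' with the point that witnesses membership in [V], so the factorization through
    chart [j] is legitimate on [W]. *)
Lemma smooth_charts_near (i : idx A) (j : idx B) (k : idx C) z :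
  smooth_charts A B f i j -> smooth_charts B C g j k ->
  dom A i z -> dom B j (f z) -> dom C k (g (f z)) ->
  exists W : set 'rV[R]_m, [/\ open W, W (crd A i z),
    W `<=` crd A i @` (dom A i `&` (g \o f) @^-1` dom C k),
    smooth_on W (fun u => loc j (crd C k \o g) (loc i (crd B j \o f) u)) &
    forall u, W u -> loc j (crd C k \o g) (loc i (crd B j \o f) u) =
      loc i (crd C k \o (g \o f)) u].
Proof.
move=> [oU sU] [oV sV] iz jz kz.
set U := _ @` _ in oU sU; set V := _ @` _ in oV sV.
pose W := U `&` (loc i (crd B j \o f)) @^-1` V.
have oW : open W by exact: open_preimage.
have Wpt u : W u -> exists z', [/\ dom A i z', dom B j (f z'),
    dom C k (g (f z')) & crd A i z' = u].
  move=> [[z' [iz' jz'] <-]]; rewrite /= locE// => -[y [jy ky] eqy].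
  exists z'; split => //.
  by rewrite -(injB jy jz' eqy).
exists W; split => //.
- split; first by exists z.
  by rewrite /= locE//; exists (f z).
- by move=> u /Wpt[z' [iz' _ kz' <-]]; exists z'.
- apply: (smooth_comp_row oW oV) sV; last by apply: smooth_subset sU => u [].
  by move=> u [].
- by move=> u /Wpt[z' [iz' jz' kz' <-]]; rewrite !locE.
Qed.

(** The intermediate chart may change with the point, because openness and smoothness are local. *)
Lemma smooth_charts_comp (i : idx A) (k : idx C) :
  (forall z, dom A i z -> dom C k (g (f z)) -> exists j,
    [/\ dom B j (f z), smooth_charts A B f i j & smooth_charts B C g j k]) ->
  smooth_charts A C (g \o f) i k.
Proof.
move=> cover; set U := crd A i @` (dom A i `&` (g \o f) @^-1` dom C k).
have localW u : U u -> exists2 W, open W /\ W u &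
    W `<=` U /\ smooth_on W (loc i (crd C k \o (g \o f))).
  move=> [z [iz kz] <-]; have [j [jz sf sg]] := cover z iz kz.
  have [W [oW Wz WU sW eqW]] := smooth_charts_near sf sg iz jz kz.
  by exists W => //; split => //; exact: smooth_ext sW.
split.
  rewrite openE => u /localW[W [oW Wu] [WU _]].
  by apply: filterS WU _; exact: open_nbhs_nbhs.
by apply: smooth_local => u /localW[W [_ Wu] [_ sW]]; exists W.
Qed.

Lemma derive_loc_comp (W : normedModType R) (h : T' -> W) (i : idx A) (j : idx B) z v :
  smooth_charts A B f i j -> dom A i z -> dom B j (f z) ->
  differentiable (loc j h) (crd B j (f z)) ->
  'D_v (loc i (h \o f)) (crd A i z) =
  'D_('D_v (loc i (crd B j \o f)) (crd A i z)) (loc j h) (crd B j (f z)).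
Proof.
move=> sf iz jz dh; have [oU _] := sf.
have <- : 'D_v (loc j h \o loc i (crd B j \o f)) (crd A i z) =
    'D_v (loc i (h \o f)) (crd A i z).
  apply: near_eq_derive; set U := _ @` _ in oU.
  have Uz : U (crd A i z) by exists z.
  apply: filterS (open_nbhs_nbhs (conj oU Uz)).
  by move=> _ [z' [iz' jz'] <-] /=; rewrite !locE.
have eqz : loc i (crd B j \o f) (crd A i z) = crd B j (f z) by rewrite locE.
by rewrite derive_comp ?eqz//; exact: smooth_charts_differentiable.
Qed.

Lemma derive_charts_comp (i : idx A) (j : idx B) (k : idx C) z v :
  smooth_charts A B f i j -> smooth_charts B C g j k ->
  dom A i z -> dom B j (f z) -> dom C k (g (f z)) ->
  'D_v (loc i (crd C k \o (g \o f))) (crd A i z) =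
  'D_('D_v (loc i (crd B j \o f)) (crd A i z)) (loc j (crd C k \o g)) (crd B j (f z)).
Proof.
move=> sf sg iz jz kz; apply: (@derive_loc_comp _ (crd C k \o g)) => //.
exact: smooth_charts_differentiable.
Qed.

End Charts.

Arguments smooth_charts {R T T' m m'} A B f i j.

Section SmoothManifold.
Context {R : realType} {M : topologicalType} {n : nat} {A : atlas R M n}.
Hypothesis mfA : smooth_manifold A.

Lemma manifold_injective : chart_injective A.
Proof. by case: mfA => _ _ _ chA _; apply/chart_injectiveP => i; case: (chA i). Qed.

Lemma manifold_transition i j : smooth_charts A A id i j.
Proof. by case: mfA => _ _ _ _ [_]; exact. Qed.

End SmoothManifold.

(** * The induced charts of the cotangent bundle *)

Section CotangentCharts.
Context {R : realType} {M : topologicalType} {n : nat} {A : atlas R M n}.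
Hypothesis mfA : smooth_manifold A.
Implicit Types (z : cotangent A) (i j l : idx A).
Let injA := manifold_injective mfA.
Local Notation E a := (delta_mx 0 a : 'rV[R]_n).
Local Notation A0 := (cot0 A).

Definition jacobian_entry i j (a b : 'I_n) (x : 'rV[R]_n) : R :=
  'D_(E a) (loc i (crd A j)) x 0 b.

Definition overlap i j := crd A i @` (dom A i `&` dom A j).

Lemma open_overlap i j : open (overlap i j).
Proof. by have [oU _] := manifold_transition mfA i j. Qed.

Lemma smooth_transition i j : smooth_on (overlap i j) (loc i (crd A j)).
Proof. by have [_] := manifold_transition mfA i j. Qed.

Lemma transition_overlap i j u : overlap i j u -> overlap j i (loc i (crd A j) u).
Proof. by move=> [x [ix jx] <-]; rewrite locE//; exists x. Qed.

Lemma smooth_jacobian i j a b : smooth_on (overlap i j) (jacobian_entry i j a b).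
Proof.
have oU := @open_overlap i j; move: b; apply/smooth_row => //.
apply: smooth_derive; exact: smooth_transition.
Qed.

(** This is the chain rule for the identity written as [id \o id]. The cocycle rule makes a covector
    prescribed in one chart consistent in all of them. *)
Lemma jacobian_comp i j l x a c : dom A i x -> dom A j x -> dom A l x ->
  jacobian_entry i l a c (crd A i x) =
  \sum_b jacobian_entry i j a b (crd A i x) * jacobian_entry j l b c (crd A j x).
Proof.
move=> ix jx lx; rewrite /jacobian_entry.
have -> : loc i (crd A l) = loc i (crd A l \o (id \o id)) by [].
rewrite (derive_charts_comp (B := A) (j := j) injA injA) //; try exact: manifold_transition.
rewrite derive_lincomb; last first.
  by apply: (smooth_charts_differentiable (manifold_transition mfA j l)).
by rewrite summxE; apply: eq_bigr => b _; rewrite mxE.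
Qed.

Lemma jacobian_self i x a b : dom A i x ->
  jacobian_entry i i a b (crd A i x) = (a == b)%:R.
Proof.
move=> ix; rewrite /jacobian_entry.
have -> : 'D_(E a) (loc i (crd A i)) (crd A i x) = 'D_(E a) id (crd A i x).
  apply: near_eq_derive.
  have Ux : overlap i i (crd A i x) by exists x.
  apply: filterS (open_nbhs_nbhs (conj (@open_overlap i i) Ux)).
  by move=> _ [y [iy _] <-]; rewrite locE.
by rewrite derive_id mxE eqxx /= eq_sym.
Qed.

Lemma cotangent_ext z z' : base z = base z' -> covec z = covec z' -> z = z'.
Proof.
case: z z' => x p hp [x' p' hp'] /= eqx eqp; subst x' p'.
by congr Cotangent; exact: Prop_irrelevance.
Qed.

Lemma covec_trans z i j : dom A i (base z) -> dom A j (base z) -> forall a,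
  covec z i 0 a = \sum_b jacobian_entry i j a b (crd A i (base z)) * covec z j 0 b.
Proof. by case: (covecP z) => _; exact. Qed.

(** Charts around the base point are linked by the transformation law and all others carry 0, so one
    row of components fixes the covector. *)
Lemma covec_eq z z' i : dom A i (base z) -> base z = base z' ->
  covec z i = covec z' i -> z = z'.
Proof.
move=> iz eqz eqi; apply: cotangent_ext => //; apply/funext => j.
have [jz|jz] := pselect (dom A j (base z)); last first.
  have [-> //] := covecP z; have [-> //] := covecP z'.
  by rewrite -eqz.
apply/rowP => a; rewrite !(@covec_trans _ j i) -?eqz ?eqi//.
Qed.

Lemma covec_neq0 z i : dom A i (base z) ->
  covec z <> (fun=> 0) <-> covec z i != 0.
Proof.
move=> iz; split=> [z0|z0 eqz]; last by rewrite eqz eqxx in z0.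
apply/eqP => zi0; apply: z0; apply/funext => j.
have [jz|jz] := pselect (dom A j (base z)); last by have [-> //] := covecP z.
apply/rowP => a; rewrite (@covec_trans _ j i)// zi0 big1 ?mxE// => b _.
by rewrite mxE mulr0.
Qed.

Lemma cotangent_exists i x (p : 'rV[R]_n) : dom A i x ->
  exists2 z, base z = x & covec z i = p.
Proof.
move=> ix.
pose q l : 'rV[R]_n := if `[< dom A l x >]
  then \row_a \sum_b jacobian_entry l i a b (crd A l x) * p 0 b else 0.
have hq : is_covector x q.
  split=> [l lx|l l' lx l'x a]; rewrite /q; first by case: asboolP.
  rewrite !asboolT//.
  rewrite mxE; under eq_bigr do rewrite (jacobian_comp _ _ lx l'x ix) mulr_suml.
  rewrite exchange_big /=; apply: eq_bigr => b _; rewrite mxE mulr_sumr.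
  by apply: eq_bigr => c _; rewrite -mulrA.
exists (Cotangent hq) => //=; rewrite /q; case: asboolP => // _.
apply/rowP => a; rewrite mxE (bigD1 a)//= jacobian_self// eqxx mul1r big1 ?addr0//.
by move=> b ba; rewrite jacobian_self// eq_sym (negbTE ba) mul0r.
Qed.

Lemma cot0_injective : chart_injective A0.
Proof.
move=> i z z' [iz _] [iz' _] /= /eq_row_mx[eqx eqp].
by apply: (covec_eq iz) => //; exact: injA eqx.
Qed.

(** Every nonzero row occurs as a covector by [cotangent_exists], so the image is a full product.
    Openness and the domain of the polar coordinates are read off from this. *)
Lemma cot0_image i j : crd A0 i @` (dom A0 i `&` dom A0 j) =
  [set u | overlap i j (lsubmx u) /\ rsubmx u != 0].
Proof.
apply/seteqP; split=> [_ [z [[iz z0] [jz _]] <-]|u [[x [ix jx] eqx] u0]].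
  rewrite /= row_mxKl row_mxKr; split; first by exists (base z).
  exact/covec_neq0.
have [z zx zp] := cotangent_exists (rsubmx u) ix.
have z0 : covec z <> (fun=> 0) by apply/(@covec_neq0 _ i); rewrite ?zx ?zp.
exists z; first by split; split=> //; rewrite zx.
by rewrite /= zx zp eqx hsubmxK.
Qed.

Lemma open_neq0 m : open [set p : 'rV[R]_m | p != 0].
Proof.
have -> : [set p : 'rV[R]_m | p != 0] = ~` [set 0].
  by apply/seteqP; split=> p /= /eqP.
apply: closed_openC; apply: accessible_closed_set1.
exact/hausdorff_accessible/norm_hausdorff.
Qed.

Lemma open_cot0_image i j : open (crd A0 i @` (dom A0 i `&` dom A0 j)).
Proof.
rewrite cot0_image.
have sl : smooth_on setT (@lsubmx R 1 n n).
  by apply: smooth_lsubmx => //; [exact: openT|apply: smooth_id; exact: openT].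
have sr : smooth_on setT (@rsubmx R 1 n n).
  by apply: smooth_rsubmx => //; [exact: openT|apply: smooth_id; exact: openT].
have := openI (open_preimage openT (@open_overlap i j) sl)
  (open_preimage openT (@open_neq0 n) sr).
by rewrite !setTI.
Qed.

Lemma cot0_transition i j : smooth_charts A0 A0 id i j.
Proof.
split; first exact: open_cot0_image.
have oU := @open_cot0_image i j; set U := _ @` _ in oU *.
have Uoverlap u : U u -> overlap i j (lsubmx u).
  by rewrite /U cot0_image => -[].
have sx : smooth_on U (fun u => lsubmx u).
  by apply: smooth_lsubmx => //; exact: smooth_id.
have sp : smooth_on U (fun u => rsubmx u).
  by apply: smooth_rsubmx => //; exact: smooth_id.
have spsi : smooth_on U (fun u => loc i (crd A j) (lsubmx u)).
  apply: (smooth_comp_row oU (@open_overlap i j)) => //.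
  exact: smooth_transition.
(* Covector components transform with the Jacobian of the inverse change of charts, from [j] to [i],
   taken at the image point. *)
apply: (@smooth_ext _ _ _ _ (fun u => row_mx (loc i (crd A j) (lsubmx u))
  (\row_a \sum_b jacobian_entry j i a b (loc i (crd A j) (lsubmx u)) * rsubmx u 0 b))) => //.
  move=> _ [z [iz jz] <-]; rewrite /= row_mxKl row_mxKr.
  rewrite (locE _ cot0_injective)//=; case: iz jz => iz _ [jz _].
  rewrite locE//; congr row_mx; apply/rowP => a; rewrite mxE.
  by rewrite (@covec_trans _ j i).
apply: smooth_row_mx => //; apply/smooth_row => // a.
rewrite (_ : (fun _ => _) = fun u => \sum_b
   jacobian_entry j i a b (loc i (crd A j) (lsubmx u)) * rsubmx u 0 b); last first.
  by apply/funext => u; rewrite mxE.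
apply: smooth_sum => // b; apply: smooth_mul => //; last exact: (smooth_row _ oU).1.
apply: (smooth_comp oU (@open_overlap j i)) => //; last exact: smooth_jacobian.
by move=> u /Uoverlap; exact: transition_overlap.
Qed.

End CotangentCharts.

(** * Euler's identities and the distribution V_{C*} *)

Lemma is_derive_affine (R : realType) (c : R) :
  is_derive (0 : R) (1 : R) ((cst 1 + id) * cst c) c.
Proof.
have d1 := is_deriveD (is_derive_cst (1 : R) (0 : R) (1 : R)) (is_derive_id (0 : R) (1 : R)).
apply: is_derive_eq (is_deriveM d1 (is_derive_cst c (0 : R) (1 : R))) _.
by rewrite scaler0 !add0r; exact: mulr1.
Qed.

Section Euler.
Context {R : realType} {n : nat}.
Implicit Types (u v w : 'rV[R]_(n + n)) (f : 'rV[R]_(n + n) -> R).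

Lemma row_mx_delta_r (i : 'I_n) :
  row_mx 0 (delta_mx 0 i) = delta_mx 0 (rshift n i) :> 'rV[R]_(n + n).
Proof.
apply/rowP => j; case: (split_ordP j) => k ->; rewrite ?row_mxEl ?row_mxEr !mxE eqxx /=.
  by rewrite eq_lrshift.
by rewrite (inj_eq (@rshift_inj _ _)).
Qed.

Lemma derive_vertical f u v : differentiable f u -> lsubmx v = 0 ->
  'D_v f u = \sum_i rsubmx v 0 i * ddp i f u.
Proof.
move=> df v0; rewrite (derive_lincomb _ df) big_split_ord /= big1 ?add0r.
  by apply: eq_bigr => i _; rewrite /ddp row_mx_delta_r mxE.
move=> i _; have /rowP/(_ i) := v0; rewrite !mxE => ->; exact: scale0r.
Qed.

Lemma derive_sqr f u v : differentiable f u ->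
  'D_v (fun w => f w ^+ 2) u = 2 * (f u * 'D_v f u).
Proof.
move=> df; have dfv : derivable f u v by exact: diff_derivable.
have -> : (fun w => f w ^+ 2) = f * f by apply/funext => w; rewrite expr2.
by rewrite deriveM// -mulr2n mulr_natl.
Qed.

Variables (k : 'rV[R]_(n + n) -> R) (U : set 'rV[R]_(n + n)).
Hypotheses (oU : open U) (sk : smooth_on U k).
Hypothesis homk : forall u l, U u -> 0 < l ->
  k (row_mx (lsubmx u) (l *: rsubmx u)) = l * k u.

Let dk u : U u -> differentiable k u.
Proof. exact: smooth_differentiable. Qed.

Let F u := k u ^+ 2.

Let sF : smooth_on U F.
Proof.
by apply: (@smooth_ext _ _ _ _ (fun u => k u * k u)) => //; exact: smooth_mul.
Qed.

Let dF u : U u -> differentiable F u.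
Proof. exact: smooth_differentiable. Qed.

Let dDF i u : U u -> differentiable (ddp i F) u.
Proof.
apply: smooth_differentiable => //; rewrite /ddp row_mx_delta_r.
exact: smooth_derive.
Qed.

(** Differentiate k(x, (1 + t) p) = (1 + t) k(x, p) at t = 0; homogeneity applies as long as 1 + t >
    0, hence for t near 0. *)
Lemma euler_identity u : U u -> 'D_(row_mx 0 (rsubmx u)) k u = k u.
Proof.
move=> Uu; set w := row_mx _ _.
have u0 : u + (0 : R) *: w = u by rewrite scale0r addr0.
have dkw : derivable k u w by apply: diff_derivable; exact: dk.
have := @is_derive_line _ _ k u w 0; rewrite u0 => /(_ dkw).
have lin t : 0 < 1 + t -> (cst 1 + id) t * k u = k (u + t *: w).
  move=> t0; rewrite -(homk Uu t0) -[in RHS](hsubmxK u) scale_row_mx scaler0.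
  by rewrite add_row_mx addr0 scalerDl scale1r.
have nearlin : \forall t \near (0 : R), k (u + t *: w) = ((cst 1 + id) * cst (k u)) t.
  near=> t; apply/esym/lin; rewrite -ltrBlDl sub0r.
  by near: t; apply: lt_nbhsr; rewrite oppr_lt0.
move=> /(near_eq_is_derive nearlin) [_ <-].
by have [_ ->] := is_derive_affine (k u).
Unshelve. all: by end_near. Qed.

Lemma euler_sqr u : U u -> \sum_j rsubmx u 0 j * ddp j F u = 2 * F u.
Proof.
move=> Uu; rewrite -[rsubmx u](row_mxKr (0 : 'rV[R]_n)).
rewrite -(derive_vertical (dF Uu)) ?row_mxKl//.
by rewrite (derive_sqr _ (dk Uu)) euler_identity// -expr2.
Qed.

(** Differentiating p_j D_j F = 2 F with respect to p_i gives D_i F + p_j D_i D_j F = 2 D_i F. *)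
Lemma euler_hessian u i : U u ->
  \sum_j rsubmx u 0 j * ddp i (ddp j F) u = ddp i F u.
Proof.
move=> Uu; pose h := \sum_j ((fun w : 'rV[R]_(n + n) => w 0 (rshift n j)) * ddp j F).
have eqh : ddp i h u = 2 * ddp i F u.
  have -> : ddp i h u = ddp i (cst 2 * F) u.
    apply: near_eq_derive; apply: filterS (open_nbhs_nbhs (conj oU Uu)) => w Uw.
    rewrite /h fct_sumE -[RHS](euler_sqr Uw); apply: eq_bigr => j _.
    by rewrite mxE.
  rewrite /ddp deriveM//; last exact/diff_derivable/dF.
  by rewrite derive_cst scaler0 addr0.
have dcoord j : derivable (fun w : 'rV[R]_(n + n) => w 0 (rshift n j)) u
    (row_mx 0 (delta_mx 0 i)).
  by apply: diff_derivable; exact: differentiable_coord.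
have dDFi j : derivable (ddp j F) u (row_mx 0 (delta_mx 0 i)).
  by apply: diff_derivable; exact: dDF.
move: eqh; rewrite /ddp /h derive_sum => [eqh|j]; last exact: derivableM.
have coordD j : 'D_(row_mx 0 (delta_mx 0 i)) (fun w : 'rV[R]_(n + n) => w 0 (rshift n j)) u
    = (j == i)%:R.
  rewrite -(derive_row _ _ (F := id))// derive_id row_mxEr mxE eqxx /=.
  by rewrite eq_sym.
have term j : 'D_(row_mx 0 (delta_mx 0 i))
    ((fun w : 'rV[R]_(n + n) => w 0 (rshift n j)) * ddp j F) u =
    rsubmx u 0 j * ddp i (ddp j F) u + ddp j F u * (j == i)%:R.
  by rewrite deriveM// coordD mxE.
move: eqh; under eq_bigr do rewrite term.
rewrite big_split /= [X in _ + X](bigD1 i)//= eqxx mulr1 [X in _ + (_ + X)]big1.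
  by rewrite addr0 mulr_natl mulr2n => /addIr.
by move=> j /negbTE ->; rewrite mulr0.
Qed.

Lemma G_loc_liouville u v (a : R) : U u -> lsubmx v = 0 ->
  G_loc k u v (row_mx 0 (a *: rsubmx u)) = a * (k u * 'D_v k u).
Proof.
move=> Uu v0; rewrite /G_loc big1 ?add0r; last first.
  by move=> i _; rewrite big1// => j _; rewrite v0 mxE mulr0 mul0r.
(* On vertical vectors the horizontal half of the metric vanishes and the forms [delta_p] reduce to
   the dp-components. *)
have delta0 (w : 'rV[R]_(n + n)) i : lsubmx w = 0 -> delta_p k u i w = rsubmx w 0 i.
  move=> w0; rewrite /delta_p big1 ?subr0// => j _.
  by rewrite w0 mxE mulr0.
have -> : a * (k u * 'D_v k u) = a * (2^-1 * 'D_v F u).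
  by rewrite (derive_sqr _ (dk Uu)) mulKf.
rewrite (derive_vertical (dF Uu))//.
rewrite !mulr_sumr; apply: eq_bigr => i _.
rewrite -euler_hessian// !mulr_sumr; apply: eq_bigr => j _.
rewrite !delta0 ?row_mxKl// row_mxKr !mxE /F.
ring.
Qed.

(** Both Euler identities enter, for F and for its vertical derivatives. With positive definiteness
    this will exclude K = 0 off the zero section. *)
Lemma g_up_quadratic u : U u ->
  (rsubmx u *m g_up k u *m (rsubmx u)^T) 0 0 = k u ^+ 2.
Proof.
move=> Uu; rewrite mxE.
have -> : k u ^+ 2 = 2^-1 * \sum_i rsubmx u 0 i * ddp i F u.
  by rewrite euler_sqr// mulKf.
under eq_bigr do rewrite mxE mulr_suml.
rewrite exchange_big mulr_sumr /=; apply: eq_bigr => i _.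
rewrite -euler_hessian// !mulr_sumr; apply: eq_bigr => j _.
rewrite !mxE /F.
ring.
Qed.

End Euler.

(** * The distribution [V_Cstar] read in charts *)

Section LiouvilleDistribution.
Context {R : realType} {M : topologicalType} {n : nat} {A : atlas R M n}.
Variable K : cotangent A -> R.
Hypotheses (mfA : smooth_manifold A) (cK : cartan_structure K).
Implicit Types (z : cotangent A) (i j : idx A).
Let injA := manifold_injective mfA.
Let injA0 := cot0_injective mfA.
Local Notation A0 := (cot0 A).
Local Notation locK i := (@loc R _ _ A0 R i K).
Local Notation chart i := (crd A0 i @` dom A0 i).

Lemma derive_lsubmx n1 n2 (u v : 'rV[R]_(n1 + n2)) :
  'D_v (@lsubmx R 1 n1 n2) u = lsubmx v.
Proof. by apply: derive_linear; exact: continuous_lsubmx. Qed.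

Lemma open_chart i : open (chart i).
Proof. by have := @open_cot0_image _ _ _ _ mfA i i; rewrite setIid. Qed.

Lemma smooth_locK i : smooth_on (chart i) (locK i).
Proof. by case: cK => _ + _ _; exact. Qed.

Lemma differentiable_locK i z : dom A0 i z -> differentiable (locK i) (crd A0 i z).
Proof.
by move=> iz; apply: (smooth_differentiable (@open_chart i) (@smooth_locK i)); exists z.
Qed.

Lemma cot_scale_dom i z (l : R) : 0 < l -> dom A0 i z -> dom A0 i (cot_scale l z).
Proof.
move=> l0 [iz z0]; split => //; apply/(covec_neq0 (i := i)) => //=.
by rewrite scaler_eq0 negb_or gt_eqF//=; exact/covec_neq0.
Qed.

Lemma locK_homogeneous i u (l : R) : chart i u -> 0 < l ->
  locK i (row_mx (lsubmx u) (l *: rsubmx u)) = l * locK i u.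
Proof.
move=> [z iz <-] l0; rewrite [in RHS]locE//.
have [_ _ homK _] := cK; rewrite -homK//.
by rewrite -(locE _ injA0 (cot_scale_dom l0 iz)) /= row_mxKl row_mxKr.
Qed.

Lemma K_gt0 i z : dom A0 i z -> 0 < K z.
Proof.
move=> iz; have [K0 _ _ posK] := cK; rewrite lt_def K0 andbT.
have Uz : chart i (crd A0 i z) by exists z.
have zi0 : covec z i != 0 by case: iz => xi z0; exact/covec_neq0.
have := posK i z iz (covec z i) zi0.
have := g_up_quadratic (@open_chart i) (@smooth_locK i) (@locK_homogeneous i) Uz.
rewrite /= row_mxKr => ->; rewrite (locE (A := A0) K injA0 iz) => K2.
by apply/eqP => Kz; rewrite Kz expr0n ltxx in K2.
Qed.

Lemma derive_base i z v : dom A0 i z ->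
  'D_v (@loc _ _ _ A0 _ i (crd A i \o @base _ _ _ A)) (crd A0 i z) = lsubmx v.
Proof.
move=> iz; have -> : 'D_v (@loc _ _ _ A0 _ i (crd A i \o @base _ _ _ A)) (crd A0 i z) =
    'D_v (@lsubmx R 1 n n) (crd A0 i z).
  apply: near_eq_derive.
  have Uz : chart i (crd A0 i z) by exists z.
  apply: filterS (open_nbhs_nbhs (conj (@open_chart i) Uz)).
  by move=> _ [z' iz' <-]; rewrite locE//= row_mxKl.
exact: derive_lsubmx.
Qed.

(** [G_metric] works in a chart picked by [xget]; this moves dK(v) from that chart to any other. *)
Lemma derive_locK_change i j z (v : idx A0 -> 'rV[R]_(n + n)) :
  tangent_at z v -> dom A0 i z -> dom A0 j z ->
  'D_(v i) (locK i) (crd A0 i z) = 'D_(v j) (locK j) (crd A0 j z).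
Proof.
move=> tv iz jz; rewrite (tv i j iz jz).
apply: (@derive_loc_comp R _ _ _ _ A0 A0 id injA0 injA0 R K) => //.
  exact: cot0_transition.
exact: differentiable_locK.
Qed.

(** The metric disappears here: both the bracket computation and the description of the leaves start
    from this form. *)
Lemma V_CstarP z (v : idx A0 -> 'rV[R]_(n + n)) : Defs.space A0 z -> V_Cstar K z v <->
  tangent_at z v /\ forall i, dom A0 i z ->
    lsubmx (v i) = 0 /\ 'D_(v i) (locK i) (crd A0 i z) = 0.
Proof.
move=> [i0 i0z]; split.
  move=> [[tv dbase] orth]; split => // i iz.
  split; first by rewrite -(derive_base _ iz) -(dbase i i)//; case: iz.
  rewrite (derive_locK_change tv iz i0z).
  (* Orthogonality is tested on C^* itself, with coefficient 1; positivity of K then removes the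
     factor K. *)
  have /orth : liouville_line z (liouville (A := A) z).
    by exists 1 => j _; rewrite scale1r.
  rewrite /G_metric; case: xgetP => [_ _ [j jz <-]|/(_ _ (ex_intro2 _ _ i0 i0z erefl))//].
  have Uz : chart j (crd A0 j z) by exists z.
  have vj0 : lsubmx (v j) = 0 by rewrite -(derive_base _ jz) -(dbase j j)//; case: jz.
  have := G_loc_liouville (@open_chart j) (@smooth_locK j) (@locK_homogeneous j) 1 Uz vj0.
  rewrite scale1r mul1r /= row_mxKr => -> /eqP.
  rewrite mulf_eq0 (locE (W := R) _ injA0 jz) gt_eqF/= ?(K_gt0 jz)// => /eqP.
  by rewrite (derive_locK_change tv jz i0z).
move=> [tv vloc]; split.
  split => // i j iz jz; have [vi0 _] := vloc i iz.
  have jz0 : dom A0 j z by case: iz.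
  have Uz : (crd A0 i @` (dom A0 i `&` dom A0 j)) (crd A0 i z) by exists z.
  (* Read in chart [i], the base coordinates of chart [j] depend on x alone, so a vector without
     dx-part kills them. *)
  have -> : 'D_(v i) (@loc _ _ _ A0 _ i (crd A j \o @base _ _ _ A)) (crd A0 i z) =
      'D_(v i) (@loc _ _ _ A _ i (crd A j) \o @lsubmx R 1 n n) (crd A0 i z).
    apply: near_eq_derive.
    have oU := @open_cot0_image _ _ _ _ mfA i j.
    apply: filterS (open_nbhs_nbhs (conj oU Uz)).
    by move=> _ [z' [iz' jz'] <-]; rewrite locE//= row_mxKl locE//; case: iz'.
  rewrite derive_comp; last 2 first.
  - exact: differentiable_lsubmx.
  - rewrite /= row_mxKl.
    by apply: (smooth_charts_differentiable (manifold_transition mfA i j)) => //; case: iz.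
  by rewrite derive_lsubmx vi0 derive0.
move=> w [a wa]; rewrite /G_metric; case: xgetP => // _ _ [j jz <-].
have [vj0 dvj] := vloc j jz.
have Uz : chart j (crd A0 j z) by exists z.
rewrite wa// /liouville scale_row_mx scaler0.
have := G_loc_liouville (@open_chart j) (@smooth_locK j) (@locK_homogeneous j) a Uz vj0.
by rewrite /= row_mxKr dvj !mulr0.
Qed.

End LiouvilleDistribution.

(** * Involutivity *)

Section Involutivity.
Context {R : realType} {M : topologicalType} {n : nat} {A : atlas R M n}.
Hypothesis mfA : smooth_manifold A.
Implicit Types (z : cotangent A) (i j : idx (cot0 A)).
Let injA0 := cot0_injective mfA.
Local Notation A0 := (cot0 A).
Local Notation chart i := (crd A0 i @` dom A0 i).
Local Notation locX X i := (@loc R _ _ A0 _ i (X ^~ i)).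
Implicit Types X Y : cotangent A -> idx A0 -> 'rV[R]_(n + n).

Let nbhs_chart i z : dom A0 i z -> nbhs (crd A0 i z) (chart i).
Proof.
move=> iz; apply: open_nbhs_nbhs; split; last by exists z.
exact: (@open_chart _ _ _ _ mfA).
Qed.

Let differentiable_field X i z : vector_field X -> dom A0 i z ->
  differentiable (locX X i) (crd A0 i z).
Proof.
move=> [_ sX] iz.
apply: (smooth_differentiable_row (@open_chart _ _ _ _ mfA i) (sX i)).
by exists z.
Qed.

(** Let f be the c-th coordinate of the transition from [i] to [j]. The transformation law of Y says
    that Y f is the c-th component of Y in chart [j], and the chain rule moves the derivative along
    X to that chart. *)
Let iterated_derivative X Y i j z c : vector_field X -> vector_field Y ->
  dom A0 i z -> dom A0 j z ->
  'D_(X z i) (fun w => 'D_(locX Y i w) (fun u => loc i (crd A0 j) u 0 c) w)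
    (crd A0 i z) = ('D_(X z j) (locX Y j) (crd A0 j z)) 0 c.
Proof.
move=> vX vY iz jz; have [tX _] := vX; have [tY _] := vY.
have spz : Defs.space A0 z by exists i.
have trans := cot0_transition mfA i j.
pose h y := Y y j 0 c.
have hE u : chart j u -> locX Y j u 0 c = loc j h u.
  by move=> [y jy <-]; rewrite !locE.
have dh : differentiable (loc j h) (crd A0 j z).
  have oj := @open_chart _ _ _ _ mfA j.
  have sh : smooth_on (chart j) (loc j h).
    apply: smooth_ext hE _ => //; apply: (smooth_row _ oj).1.
    by case: vY.
  by apply: (smooth_differentiable oj sh); exists z.
rewrite derive_row; last exact: differentiable_field.
have -> : 'D_(X z j) (fun u => locX Y j u 0 c) (crd A0 j z) =
    'D_(X z j) (loc j h) (crd A0 j z).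
  by apply: near_eq_derive; apply: filterS (nbhs_chart jz).
rewrite (tX z spz i j iz jz).
rewrite -(@derive_loc_comp R _ _ _ _ A0 A0 id injA0 injA0 _ h i j z)//.
have [oU sU] := trans; set U := _ @` _ in oU sU.
have Uz : U (crd A0 i z) by exists z.
apply: near_eq_derive; apply: filterS (open_nbhs_nbhs (conj oU Uz)).
move=> _ [z' [iz' jz'] <-]; rewrite !locE//=.
have spz' : Defs.space A0 z' by exists i.
rewrite /h (tY z' spz' i j iz' jz').
apply/esym/derive_row; exact: smooth_charts_differentiable trans iz' jz'.
Qed.

Lemma bracket_tangent X Y z : vector_field X -> vector_field Y ->
  tangent_at z (bracket X Y z).
Proof.
move=> vX vY i j iz jz; have trans := cot0_transition mfA i j.
have [oU sU] := trans; set U := _ @` _ in oU sU.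
have Uz : U (crd A0 i z) by exists z.
have UC : U `<=` chart i by move=> _ [y [iy _] <-]; exists y.
apply/rowP => c; rewrite derive_row; last exact: smooth_charts_differentiable.
have locXz : locX X i (crd A0 i z) = X z i by rewrite locE.
have locYz : locX Y i (crd A0 i z) = Y z i by rewrite locE.
have CU Z : vector_field Z -> Ck 1 U (locX Z i).
  by move=> [_ sZ]; apply: smooth_subset UC (sZ i) _.
have Cf : Ck 2 U (fun u => loc i (crd A0 j) u 0 c).
  exact: (smooth_row _ oU).1 sU c 2.
have := derive_bracket oU Cf (CU X vX) (CU Y vY) Uz.
rewrite locXz locYz => /esym; apply: etrans.
apply: etrans (congr2 (fun a b : R => a - b) (esym (iterated_derivative c vX vY iz jz))
  (esym (iterated_derivative c vY vX iz jz))).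
by rewrite /bracket !mxE.
Qed.

Lemma bracket_vector_field X Y :
  vector_field X -> vector_field Y -> vector_field (bracket X Y).
Proof.
move=> vX vY; split=> [z _|i]; first exact: bracket_tangent.
have [[_ sX] [_ sY]] := (vX, vY); have oi := @open_chart _ _ _ _ mfA i.
apply: (@smooth_ext _ _ _ _ (fun u =>
  'D_(locX X i u) (locX Y i) u + (-1) *: 'D_(locX Y i u) (locX X i) u)) => //.
  by move=> _ [z iz <-]; rewrite !locE// scaleN1r.
apply: smooth_addr => //; first exact: smooth_derive_along.
apply: smooth_scale => //; first exact: smooth_cst.
exact: smooth_derive_along.
Qed.

(** X f and Y f vanish on the whole chart, hence near z, so both iterated derivatives in the bracket
    formula are 0. *)
Lemma derive_bracket_eq0 X Y i z (f : 'rV[R]_(n + n) -> R) :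
  vector_field X -> vector_field Y -> dom A0 i z -> smooth_on (chart i) f ->
  (forall y, dom A0 i y -> 'D_(X y i) f (crd A0 i y) = 0) ->
  (forall y, dom A0 i y -> 'D_(Y y i) f (crd A0 i y) = 0) ->
  'D_(bracket X Y z i) f (crd A0 i z) = 0.
Proof.
move=> [_ sX] [_ sY] iz sf Xf Yf; have oi := @open_chart _ _ _ _ mfA i.
have locXz : locX X i (crd A0 i z) = X z i by rewrite locE.
have locYz : locX Y i (crd A0 i z) = Y z i by rewrite locE.
have Uz : chart i (crd A0 i z) by exists z.
have := derive_bracket oi (sf 2) (sX i 1) (sY i 1) Uz.
rewrite locXz locYz => ->.
have zero v (Z : cotangent A -> idx A0 -> 'rV[R]_(n + n)) :
    (forall y, dom A0 i y -> 'D_(Z y i) f (crd A0 i y) = 0) ->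
    'D_v (fun w => 'D_(locX Z i w) f w) (crd A0 i z) = 0.
  move=> Zf; rewrite -[RHS](@derive_cst _ _ R (0 : R) (crd A0 i z) v).
  apply: near_eq_derive; apply: filterS (nbhs_chart iz).
  by move=> _ [y iy <-]; rewrite locE// Zf.
by rewrite !zero// subrr.
Qed.

Lemma V_Cstar_involutive (K : cotangent A -> R) : cartan_structure K ->
  involutive_distribution (V_Cstar K).
Proof.
move=> cK X Y [vX DX] [vY DY]; split; first exact: bracket_vector_field.
move=> z spz; apply/V_CstarP => //; split; first exact: bracket_tangent.
move=> i iz.
have DXi y : dom A0 i y -> lsubmx (X y i) = 0 /\ 'D_(X y i) (@loc _ _ _ A0 _ i K) (crd A0 i y) = 0.
  move=> iy; have spy : Defs.space A0 y by exists i.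
  by have [_] := (V_CstarP mfA cK _ spy).1 (DX y spy); exact.
have DYi y : dom A0 i y -> lsubmx (Y y i) = 0 /\ 'D_(Y y i) (@loc _ _ _ A0 _ i K) (crd A0 i y) = 0.
  move=> iy; have spy : Defs.space A0 y by exists i.
  by have [_] := (V_CstarP mfA cK _ spy).1 (DY y spy); exact.
have entry (v u : 'rV[R]_(n + n)) c :
    lsubmx v 0 c = 'D_v (fun w : 'rV[R]_(n + n) => w 0 (lshift n c)) u.
  by rewrite -(derive_row _ _ (F := id))// derive_id mxE.
split; last first.
  apply: derive_bracket_eq0 => //; first exact: smooth_locK.
    by move=> y /DXi[].
  by move=> y /DYi[].
apply/rowP => c; rewrite (entry _ (crd A0 i z)) mxE.
apply: derive_bracket_eq0 => //; first exact: smooth_coord.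
  by move=> y /DXi[]; rewrite -entry => ->; rewrite mxE.
by move=> y /DYi[]; rewrite -entry => ->; rewrite mxE.
Qed.

End Involutivity.

(** * The foliation and its leaves *)

Section PolarCoordinates.
Context {R : realType} {n : nat}.
Implicit Types (u w : 'rV[R]_(n.+1 + n.+1)) (p : 'rV[R]_n.+1) (Q : 'M[R]_n.+1).

Lemma exists_frame p : p != 0 -> exists2 Q, Q \in unitmx & 0 < (p *m Q) 0 0.
Proof.
move=> p0; have r1 : \rank p = 1 by apply/eqP; rewrite eqn_leq rank_leq_row lt0n mxrank_eq0.
pose c := col_ebase p 0 0.
have c0 : c != 0.
  have := col_ebase_unit p; rewrite unitmxE det_mx11 unitfE.
  exact.
(* A row of rank 1 is p = c e_0 E with E = [row_ebase p]; this frame makes the first entry of pQ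
   equal to c^2, positive whatever the sign of c. *)
exists (c *: invmx (row_ebase p)).
  rewrite unitmxZ ?unitfE//; by rewrite unitmx_inv row_ebase_unit.
rewrite -scalemxAr -{1}[p]mulmx_ebase mulmxK ?row_ebase_unit// r1 !mxE.
rewrite big_ord1 mxE !eqxx /= mulr1 -/c.
by rewrite lt_def mulf_neq0// -expr2 sqr_ge0.
Qed.

Variable k : 'rV[R]_(n.+1 + n.+1) -> R.

(* (x, p) |-> (x, k(x, p), y), where pQ is a positive multiple of (1, y). *)
Definition polar_map Q u : 'rV[R]_(n.+1 + n.+1) :=
  let q : 'rV[R]_(1 + n) := rsubmx u *m Q in
  row_mx (lsubmx u)
    (row_mx (const_mx (k u) : 'rV[R]_1) ((q 0 0)^-1 *: rsubmx q) : 'rV[R]_(1 + n)).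

Definition polar_covector Q w : 'rV[R]_n.+1 :=
  (row_mx (const_mx 1 : 'rV[R]_1) (rsubmx (rsubmx w : 'rV[R]_(1 + n))) : 'rV[R]_(1 + n))
    *m invmx Q.

(** By homogeneity, the quotient r / k is the scale at which [k] takes the prescribed value r on the
    ray through [polar_covector Q w]. *)
Definition polar_inv Q w : 'rV[R]_(n.+1 + n.+1) :=
  row_mx (lsubmx w)
    ((rsubmx w 0 0 / k (row_mx (lsubmx w) (polar_covector Q w))) *: polar_covector Q w).

Variable X : set 'rV[R]_n.+1.
Hypothesis oX : open X.
Let U := [set u : 'rV[R]_(n.+1 + n.+1) | X (lsubmx u) /\ rsubmx u != 0].
Hypotheses (oU : open U) (sk : smooth_on U k) (k_gt0 : forall u, U u -> 0 < k u).
Hypothesis homk : forall u l, U u -> 0 < l ->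
  k (row_mx (lsubmx u) (l *: rsubmx u)) = l * k u.
Variable Q : 'M[R]_n.+1.
Hypothesis unitQ : Q \in unitmx.

Definition polar_source := [set u | U u /\ 0 < (rsubmx u *m Q) 0 0].
Definition polar_target :=
  [set w : 'rV[R]_(n.+1 + n.+1) | X (lsubmx w) /\ 0 < rsubmx w 0 0].

Let row0 (a : R) (y : 'rV[R]_n) :
  (row_mx (const_mx a : 'rV[R]_1) y : 'rV[R]_(1 + n)) 0 0 = a.
Proof.
have -> : 0 = lshift n (0 : 'I_1) by apply/val_inj.
by rewrite row_mxEl mxE.
Qed.

Let row1E (y : 'rV[R]_(1 + n)) :
  y = row_mx (const_mx (y 0 0)) (rsubmx y).
Proof.
rewrite -[LHS]hsubmxK; congr row_mx; apply/rowP => a; rewrite !mxE ord1.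
by congr (y _ _); exact/val_inj.
Qed.

Let polar_covector_neq0 w : polar_covector Q w != 0.
Proof.
apply/eqP => /(congr1 (mulmx^~ Q)); rewrite mulmxKV// mul0mx => /rowP/(_ 0).
by rewrite row0 mxE => /eqP; rewrite oner_eq0.
Qed.

Let cone w : X (lsubmx w) -> U (row_mx (lsubmx w) (polar_covector Q w)).
Proof. by move=> Xw; split; rewrite ?row_mxKl ?row_mxKr. Qed.

Lemma polar_mapP u : polar_source u ->
  polar_target (polar_map Q u) /\ polar_inv Q (polar_map Q u) = u.
Proof.
move=> [Uu q0]; have [Xu u0] := Uu; have ku := k_gt0 Uu.
split; first by split; rewrite ?row_mxKl ?row_mxKr ?row0.
set s := (rsubmx u *m Q) 0 0 in q0.
(* Dividing pQ by its first entry s gives (1, y), so the recovered direction is p / s, where [k] is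
   k(u) / s; the scale in [polar_inv] is therefore s. *)
have covE : polar_covector Q (polar_map Q u) = s^-1 *: rsubmx u.
  rewrite /polar_covector /polar_map row_mxKr row_mxKr.
  apply: (canLR (mulmxK unitQ)); rewrite -scalemxAl.
  apply: (etrans _ (congr1 ( *:%R s^-1) (esym (row1E _)))).
  rewrite -/s scale_row_mx; congr row_mx.
  by apply/rowP => a; rewrite !mxE mulVf ?gt_eqF.
rewrite /polar_inv covE [lsubmx (polar_map _ _)]row_mxKl homk ?invr_gt0//.
rewrite [rsubmx (polar_map _ _)]row_mxKr row0 scalerA.
rewrite invfM invrK mulrCA mulfV ?gt_eqF// mulr1 mulfV ?gt_eqF// scale1r.
exact: hsubmxK.
Qed.

Lemma polar_invP w : polar_target w ->
  polar_source (polar_inv Q w) /\ polar_map Q (polar_inv Q w) = w.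
Proof.
move=> [Xw r0]; have Uw := cone Xw; have kw := k_gt0 Uw.
set q := polar_covector Q w in Uw kw *.
pose c := rsubmx w 0 0 / k (row_mx (lsubmx w) q).
have c0 : 0 < c by rewrite divr_gt0.
have qQ : q *m Q = row_mx (const_mx 1 : 'rV[R]_1) (rsubmx (rsubmx w : 'rV[R]_(1 + n))).
  by rewrite /q mulmxKV.
have cqQ : (c *: q) *m Q = row_mx (const_mx c : 'rV[R]_1)
    (c *: rsubmx (rsubmx w : 'rV[R]_(1 + n))).
  rewrite -scalemxAl qQ; apply: (etrans (scale_row_mx c (const_mx 1 : 'rV[R]_1) _)).
  congr row_mx.
  by apply/rowP => a; rewrite !mxE mulr1.
have kc : k (row_mx (lsubmx w) (c *: q)) = rsubmx w 0 0.
  have := homk Uw c0; rewrite row_mxKl row_mxKr => ->.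
  by rewrite /c divfK// gt_eqF.
split.
  split; last by rewrite row_mxKr cqQ row0.
  split; rewrite ?row_mxKl ?row_mxKr// scaler_eq0 negb_or gt_eqF//=.
rewrite /polar_map [polar_inv Q w]/(row_mx (lsubmx w) (c *: q)) kc row_mxKl row_mxKr cqQ.
rewrite row0 row_mxKr scalerA mulVf ?gt_eqF// scale1r -row1E.
exact: hsubmxK.
Qed.

Lemma open_gt0 m V (f : 'rV[R]_m -> R) : open V -> smooth_on V f ->
  open [set u | V u /\ 0 < f u].
Proof.
move=> oV sf; rewrite openE => u [Vu fu]; apply: filterI.
  exact: open_nbhs_nbhs.
have fu_nbhs : nbhs (f u) [set t : R | 0 < t].
  by apply: open_nbhs_nbhs; split => //; exact: open_gt.
exact: (smooth_continuous sf Vu fu_nbhs).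
Qed.

Let smooth_frame : smooth_on U (fun u => rsubmx u *m Q).
Proof. by apply: smooth_mulmxr => //; apply: smooth_rsubmx => //; exact: smooth_id. Qed.

Lemma open_polar_source : open polar_source.
Proof. by apply: open_gt0 => //; exact: (smooth_row _ oU).1. Qed.

Lemma open_polar_target : open polar_target.
Proof.
have sl : smooth_on setT (fun w : 'rV[R]_(n.+1 + n.+1) => lsubmx w).
  by apply: smooth_lsubmx; [exact: openT|apply: smooth_id; exact: openT].
have sr : smooth_on setT (fun w : 'rV[R]_(n.+1 + n.+1) => rsubmx w 0 0).
  apply: (smooth_row _ openT).1.
  by apply: smooth_rsubmx; [exact: openT|apply: smooth_id; exact: openT].
have oXl := open_preimage openT oX sl; rewrite setTI in oXl.
exact: open_gt0 oXl (smooth_subset (@subsetT _ _) sr).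
Qed.

Lemma smooth_const_row m V (f : 'rV[R]_m -> R) : open V -> smooth_on V f ->
  smooth_on V (fun x => const_mx (f x) : 'rV[R]_1).
Proof.
move=> oV sf; apply/smooth_row => // j.
by rewrite (_ : (fun _ => _) = f)//; apply/funext => u; rewrite mxE.
Qed.

Lemma smooth_polar_map : smooth_on polar_source (polar_map Q).
Proof.
have oS := open_polar_source.
have SU : polar_source `<=` U by move=> u [].
have sQ := smooth_subset SU smooth_frame.
apply: smooth_row_mx => //; first by apply: smooth_lsubmx => //; exact: smooth_id.
apply: (smooth_row_mx (n1 := 1)) => //.
  by apply: smooth_const_row => //; exact: smooth_subset sk.
apply: smooth_scale => //.
  apply: smooth_inv => //; first by move=> u [_ /lt0r_neq0].
  exact: (smooth_row _ oS).1.
exact: (smooth_rsubmx (n1 := 1)).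
Qed.

Lemma smooth_polar_inv : smooth_on polar_target (polar_inv Q).
Proof.
have oT := open_polar_target.
have sid : smooth_on polar_target (fun w => w) by exact: smooth_id.
have sl : smooth_on polar_target (fun w => lsubmx w) by exact: smooth_lsubmx.
have sr : smooth_on polar_target (fun w => rsubmx w) by exact: smooth_rsubmx.
have sq : smooth_on polar_target (polar_covector Q).
  apply: smooth_mulmxr => //; apply: (smooth_row_mx (n1 := 1)) => //.
    exact: smooth_cst.
  exact: (smooth_rsubmx (n1 := 1)).
apply: smooth_row_mx => //; apply: smooth_scale => //.
apply: smooth_mul => //; first exact: (smooth_row _ oT).1.
apply: smooth_inv => //.
  by move=> w [Xw _]; apply/lt0r_neq0/k_gt0/cone.
apply: (smooth_comp oT oU) => //; last exact: smooth_row_mx.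
by move=> w [Xw _]; exact: cone.
Qed.

End PolarCoordinates.

Section Transverse.
Context {R : realType} {n : nat}.
Implicit Types u w : 'rV[R]_(n.+1 + n.+1).

(** The n + 2 transverse indices are the n + 1 base coordinates and the single index n + 1, which is
    the slot of K. *)
Lemma transverse_eqP u w :
  (forall c : 'I_(n.+1 + n.+1), (c < n.+2)%N -> u 0 c = w 0 c) <->
  lsubmx u = lsubmx w /\ rsubmx u 0 0 = rsubmx w 0 0.
Proof.
split=> [uw|[uwl uwr] c cn].
  split; last by rewrite !mxE uw//= addn0.
  by apply/rowP => c; rewrite !mxE uw//= ltnW// ltnS ltn_ord.
case: (split_ordP c) => a ca; rewrite ca in cn *.
  by have /rowP/(_ a) := uwl; rewrite !mxE.
have -> : a = 0.
  apply/val_inj => /=; move: cn => /=.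
  by rewrite ltnS -[X in (_ <= X)%N]addn0 leq_add2l leqn0 => /eqP.
by move: uwr; rewrite !mxE.
Qed.

End Transverse.

(** * The foliated atlas *)

Section PolarAtlas.
Context {R : realType} {M : topologicalType} {n : nat} {A : atlas R M n.+1}.
Variable K : cotangent A -> R.
Hypotheses (mfA : smooth_manifold A) (cK : cartan_structure K).
Local Notation A0 := (cot0 A).
Implicit Types (z : cotangent A) (i j : idx A0) (Q : 'M[R]_n.+1).
Let injA := manifold_injective mfA.
Let injA0 : chart_injective A0 := cot0_injective mfA.
Local Notation chart i := (crd A0 i @` dom A0 i).
Local Notation locK i := (@loc R _ _ A0 R i K).

(** Invertibility of Q is a condition on the domain and not on the index, so a singular Q indexes an
    empty chart. *)
Definition polar_atlas : atlas R (cotangent A) (n.+1 + n.+1) := {|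
  idx := idx A * 'M[R]_n.+1;
  dom := fun J => [set z | [/\ dom A0 J.1 z, J.2 \in unitmx & 0 < (covec z J.1 *m J.2) 0 0]];
  crd := fun J z => polar_map (locK J.1) J.2 (crd A0 J.1 z) |}.

Local Notation F := polar_atlas.
Local Notation base_chart i := (crd A i @` dom A i).

Let open_base i : open (base_chart i).
Proof. by have := @open_overlap _ _ _ _ mfA i i; rewrite /overlap setIid. Qed.

Let chartE i : chart i = [set u | base_chart i (lsubmx u) /\ rsubmx u != 0].
Proof. by have := @cot0_image _ _ _ A mfA i i; rewrite /overlap !setIid. Qed.

Let open_cone i : open [set u : 'rV[R]_(n.+1 + n.+1) | base_chart i (lsubmx u) /\ rsubmx u != 0].
Proof. rewrite -chartE; exact: (@open_chart _ _ _ _ mfA). Qed.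

Let smooth_cone i : smooth_on
  [set u : 'rV[R]_(n.+1 + n.+1) | base_chart i (lsubmx u) /\ rsubmx u != 0] (locK i).
Proof. rewrite -chartE; exact: smooth_locK. Qed.

Let pos_cone i u : base_chart i (lsubmx u) /\ rsubmx u != 0 -> 0 < locK i u.
Proof.
move=> Uu; have : chart i u by rewrite chartE.
by move=> [z iz <-]; rewrite (locE (A := A0) K injA0 iz); exact: K_gt0 iz.
Qed.

Let hom_cone i u l : base_chart i (lsubmx u) /\ rsubmx u != 0 -> 0 < l ->
  locK i (row_mx (lsubmx u) (l *: rsubmx u)) = l * locK i u.
Proof. by move=> Uu; apply: locK_homogeneous => //; rewrite chartE. Qed.

Let source_crd i Q z : dom F (i, Q) z ->
  polar_source (base_chart i) Q (crd A0 i z).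
Proof.
move=> [iz uQ q0]; split; last by rewrite /= row_mxKr.
by have : chart i (crd A0 i z) by [exists z]; rewrite chartE.
Qed.

Let polar_crdK i Q z : dom F (i, Q) z ->
  polar_inv (locK i) Q (crd F (i, Q) z) = crd A0 i z.
Proof.
move=> iQz; have [_ uQ _] := iQz.
by have [] := polar_mapP (@pos_cone i) (@hom_cone i) uQ (source_crd iQz).
Qed.

Lemma polar_crd_surj i Q w : Q \in unitmx -> polar_target (base_chart i) w ->
  exists2 z, dom F (i, Q) z & crd F (i, Q) z = w.
Proof.
move=> uQ tw; have [[]] := polar_invP (@pos_cone i) (@hom_cone i) uQ tw.
rewrite -chartE => -[z iz eqz]; rewrite -eqz /= row_mxKr => q0 eqw.
by exists z.
Qed.

Lemma polar_crd_target i Q z : dom F (i, Q) z ->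
  polar_target (base_chart i) (crd F (i, Q) z).
Proof.
move=> iQz; have [_ uQ _] := iQz.
by have [] := polar_mapP (@pos_cone i) (@hom_cone i) uQ (source_crd iQz).
Qed.

Lemma polar_injective : chart_injective F.
Proof.
move=> [i Q] z z' iz iz' eqz.
have [iz0 _ _] := iz; have [iz0' _ _] := iz'.
by apply: (injA0 iz0 iz0'); rewrite -(polar_crdK iz) -(polar_crdK iz') eqz.
Qed.

Lemma polar_cover i z : dom A0 i z -> exists Q, dom F (i, Q) z.
Proof.
move=> iz; have [xi z0] := iz.
have [Q uQ q0] := exists_frame ((@covec_neq0 _ _ _ _ z i xi).1 z0).
by exists Q.
Qed.

(** The transverse coordinates are determined by the base point and K alone. Membership in the half
    space of [J] is not among the hypotheses, which matters when a leaf leaves that half space. *)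
Lemma polar_crd_transverse J z :
  lsubmx (crd F J z) = crd A J.1 (base z) /\
  (dom A0 J.1 z -> rsubmx (crd F J z) 0 0 = K z).
Proof.
split; first by rewrite /= row_mxKl row_mxKl.
move=> Jz; rewrite /= row_mxKr.
have -> : 0 = lshift n (0 : 'I_1) by apply/val_inj.
by rewrite (row_mxEl (n1 := 1)) mxE (locE (A := A0) K injA0 Jz).
Qed.

Let image_source i Q : Q \in unitmx ->
  crd A0 i @` (dom A0 i `&` dom F (i, Q)) = polar_source (base_chart i) Q.
Proof.
move=> uQ; apply/seteqP; split=> [_ [z [iz iQz] <-]|u [Uu q0]]; first exact: source_crd.
have : chart i u by rewrite chartE.
move=> [z iz eqz]; exists z => //; split => //; split => //.
by move: q0; rewrite -eqz /= row_mxKr.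
Qed.

Lemma chart_to_polar i Q : smooth_charts A0 F id i (i, Q).
Proof.
have [uQ|nuQ] := boolP (Q \in unitmx); last first.
  have E : crd A0 i @` (dom A0 i `&` id @^-1` dom F (i, Q)) = set0.
    by apply/seteqP; split=> // u [z [_ [_]]]; rewrite (negbTE nuQ).
  by rewrite /smooth_charts E; split; [exact: open0|apply: smooth_local].
have E : crd A0 i @` (dom A0 i `&` id @^-1` dom F (i, Q)) = polar_source (base_chart i) Q.
  exact: image_source.
have oS := @open_polar_source _ _ _ (@open_cone i) Q.
rewrite /smooth_charts E; split => //.
apply: smooth_ext (smooth_polar_map (@open_cone i) (@smooth_cone i) Q) => //.
by move=> u; rewrite -E => -[z [iz _] <-]; rewrite (locE _ injA0 iz).
Qed.

Lemma polar_to_chart i Q : smooth_charts F A0 id (i, Q) i.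
Proof.
have [uQ|nuQ] := boolP (Q \in unitmx); last first.
  have E : crd F (i, Q) @` (dom F (i, Q) `&` id @^-1` dom A0 i) = set0.
    by apply/seteqP; split=> // u [z [[_ +] _]]; rewrite (negbTE nuQ).
  by rewrite /smooth_charts E; split; [exact: open0|apply: smooth_local].
have E : crd F (i, Q) @` (dom F (i, Q) `&` id @^-1` dom A0 i) = polar_target (base_chart i).
  apply/seteqP; split=> [_ [z [iQz _] <-]|w tw]; first exact: polar_crd_target.
  have [z iQz eqw] := polar_crd_surj uQ tw; exists z => //; split => //.
  by case: iQz.
have oT := @open_polar_target _ n _ (@open_base i).
rewrite /smooth_charts E; split => //.
apply: smooth_ext (smooth_polar_inv
  (@open_base i) (@open_cone i) (@smooth_cone i) (@pos_cone i) uQ) => //.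
move=> u; rewrite -E => -[z [iz _] <-].
by rewrite (locE _ polar_injective iz) polar_crdK.
Qed.

(** The explicit formula relates chart [i] to the polar charts over the same [i]; any other pair
    factors through the induced chart underlying [J]. *)
Lemma cot0_to_polar i J : smooth_charts A0 F id i J.
Proof.
apply: (@smooth_charts_comp _ _ _ _ _ _ _ A0 A0 F id id injA0 injA0) => z iz Jz.
case: J Jz => j Q jz; exists j; split; first by case: jz.
  exact: cot0_transition.
exact: chart_to_polar.
Qed.

Lemma polar_to_cot0 J i : smooth_charts F A0 id J i.
Proof.
apply: (@smooth_charts_comp _ _ _ _ _ _ _ F A0 A0 id id polar_injective injA0) => z Jz iz.
case: J Jz => j Q jz; exists j; split; first by case: jz.
  exact: polar_to_chart.
exact: cot0_transition.
Qed.

Lemma polar_to_polar J J' : smooth_charts F F id J J'.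
Proof.
apply: (@smooth_charts_comp _ _ _ _ _ _ _ F A0 F id id polar_injective injA0) => z Jz Jz'.
exists J.1; split; first by case: Jz.
  exact: polar_to_cot0.
exact: cot0_to_polar.
Qed.

Lemma polar_foliation : foliation A0 n.+2 F.
Proof.
split.
- exact/chart_injectiveP/polar_injective.
- split; last by move=> i J; exact: cot0_to_polar.
  by move=> z [i /polar_cover[Q iQz]]; exists (i, Q).
- split; last by move=> J i; exact: polar_to_cot0.
  by move=> z [J [Jz _ _]]; exists J.1.
move=> J J' z Jz Jz'; have [oO _] := polar_to_polar J J'.
set O := _ @` _ in oO.
have Oz : O (crd F J z) by exists z.
(* The whole overlap serves as neighbourhood: equal transverse coordinates mean equal base points
   and equal K, a condition that refers to no chart. *)
exists O; first exact: open_nbhs_nbhs.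
split => // _ _ [z1 [Jz1 Jz1'] <-] [z2 [Jz2 Jz2'] <-] /transverse_eqP.
rewrite !(locE _ polar_injective)//.
have [[/= b1 _ _] [/= b1' _ _]] := (Jz1, Jz1').
have [[/= b2 _ _] [/= b2' _ _]] := (Jz2, Jz2').
rewrite !(polar_crd_transverse J _).1 !(polar_crd_transverse J _).2//.
move=> [eqb eqK]; apply/transverse_eqP.
rewrite !(polar_crd_transverse J' _).1 !(polar_crd_transverse J' _).2//; split => //.
by rewrite (injA b1.1 b2.1 eqb).
Qed.

(** Since the transverse coordinates are x and K, the transverse part of a vector consists of dx(v)
    and dK(v), the quantities in [V_CstarP]. *)
Lemma derive_polar i Q z v : dom F (i, Q) z ->
  let w := 'D_v (@loc _ _ _ A0 _ i (crd F (i, Q))) (crd A0 i z) in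
  lsubmx w = lsubmx v /\ rsubmx w 0 0 = 'D_v (locK i) (crd A0 i z).
Proof.
move=> iQz w; have [iz uQ _] := iQz.
have [oU sU] := chart_to_polar i Q; set U := _ @` _ in oU sU.
have Uz : U (crd A0 i z) by exists z.
have dU : differentiable (@loc _ _ _ A0 _ i (crd F (i, Q))) (crd A0 i z).
  exact: smooth_differentiable_row sU _ Uz.
have nbhsU := open_nbhs_nbhs (conj oU Uz).
split.
  apply/rowP => c; rewrite mxE derive_row//.
  have -> : lsubmx v 0 c = 'D_v (fun u : 'rV[R]_(n.+1 + n.+1) => u 0 (lshift n.+1 c)) (crd A0 i z).
    by rewrite -(derive_row _ _ (F := id))// derive_id mxE.
  apply: near_eq_derive; apply: filterS nbhsU => _ [y [iy iQy] <-].
  by rewrite (locE _ injA0 iy) !row_mxEl mxE row_mxEl.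
rewrite mxE derive_row//; apply: near_eq_derive; apply: filterS nbhsU => _ [y [iy iQy] <-].
rewrite !(locE _ injA0 iy).
by have [_ /(_ iy)] := polar_crd_transverse (i, Q) y; rewrite mxE.
Qed.

Lemma V_Cstar_tangent_to_leaves z : Defs.space A0 z ->
  V_Cstar K z = tangent_to_leaves n.+2 F z.
Proof.
move=> spz; apply/seteqP; split=> v.
  move=> /(V_CstarP mfA cK v spz)[tv vloc]; split => //.
  have [i0 i0z] := spz.
  (* The components in all polar charts are computed from one fixed chart [i0]; [wE] is their
     independence of that choice. *)
  pose w (J : idx F) := 'D_(v i0) (@loc _ _ _ A0 _ i0 (crd F J)) (crd A0 i0 z).
  have wE (i : idx A0) (J : idx F) : dom A0 i z -> dom F J z ->
      w J = 'D_(v i) (@loc _ _ _ A0 _ i (crd F J)) (crd A0 i z).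
    move=> iz Jz; rewrite /w (tv i i0 iz i0z).
    have := @derive_charts_comp _ _ _ _ _ _ _ A0 A0 F id id injA0 injA0 i i0 J z (v i).
    by move=> <- //; [exact: cot0_transition|exact: cot0_to_polar].
  exists w; first exact: wE.
  move=> [j Q] jQz c cn; have [jz _ _] := jQz.
  have [vj0 dvj] := vloc j jz.
  rewrite (wE j (j, Q))//.
  suff /transverse_eqP/(_ c cn) -> : lsubmx ('D_(v j) (@loc _ _ _ A0 _ j (crd F (j, Q)))
      (crd A0 j z)) = lsubmx (0 : 'rV[R]_(n.+1 + n.+1)) /\
     rsubmx ('D_(v j) (@loc _ _ _ A0 _ j (crd F (j, Q))) (crd A0 j z)) 0 0 =
     rsubmx (0 : 'rV[R]_(n.+1 + n.+1)) 0 0 by rewrite mxE.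
  have [-> ->] := derive_polar (v j) jQz.
  by rewrite vj0 dvj linear0 !mxE.
move=> [tv [w dw w0]]; apply/(V_CstarP mfA cK v spz); split => // i iz.
have [Q iQz] := polar_cover iz.
have [<- <-] := derive_polar (v i) iQz.
have <- : w (i, Q) = 'D_(v i) (@loc _ _ _ A0 _ i (crd F (i, Q))) (crd A0 i z).
  exact: dw.
have /transverse_eqP[-> ->] : forall c : 'I_(n.+1 + n.+1), (c < n.+2)%N ->
    w (i, Q) 0 c = (0 : 'rV[R]_(n.+1 + n.+1)) 0 c.
  by move=> c cn; rewrite (w0 _ iQz _ cn) mxE.
by rewrite linear0 !mxE.
Qed.

End PolarAtlas.

(** * Row space as a manifold, the model of the leaves *)

Section EuclideanAtlas.
Context {R : realType} {n : nat}.

Definition euclidean_atlas : atlas R 'rV[R]_n n :=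
  {| idx := unit; dom := fun=> setT; crd := fun=> id |}.

Local Notation B := euclidean_atlas.

Lemma euclidean_injective : chart_injective B.
Proof. by move=> [] y y'. Qed.

Lemma euclidean_loc (W : normedModType R) (h : 'rV[R]_n -> W) i :
  @loc _ _ _ B _ i h = h.
Proof. by apply/funext => y; exact: (locE (A := B) h euclidean_injective). Qed.

Lemma second_countable_rV : @second_countable 'rV[R]_n.
Proof.
pose b (q : 'rV[rat]_n * nat) : set 'rV[R]_n := ball (map_mx ratr q.1 : 'rV[R]_n) q.2.+1%:R^-1.
exists (range b); first exact: card_le_trans (card_image_le _ _) (countableP _).
split; first by move=> _ [q _ <-]; exact: ball_open.
move=> x V /nbhs_ballP[e /= e0 xeV].
(* A ball of radius less than e / 2 that contains x lies within e of x. *)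
have [k _ ke] : exists2 k, True & k.+1%:R^-1 < e / 2.
  have [|k] := @ltr_add_invr R 0 (e / 2); first by rewrite divr_gt0.
  by rewrite add0r => ?; exists k.
pose d : R := k.+1%:R^-1; have d0 : 0 < d by rewrite invr_gt0.
(* Half the radius is taken because coordinatewise bounds give only a weak inequality for the norm,
   and a strict one is wanted. *)
have near_q j : exists q : rat, `|x 0 j - ratr q| <= d / 2.
  have [|q] := @rat_in_itvoo R (x 0 j - d / 2) (x 0 j + d / 2).
    by rewrite ltrD2l gtrN// divr_gt0.
  by rewrite in_itv /= => /andP[xq qx]; exists q; rewrite distrC ler_distl !ltW.
have [q xq] := choice near_q.
have xqd : `|x - map_mx ratr (\row_j q j)| < d.
  apply: (@le_lt_trans _ _ (d / 2)); last by rewrite gtr_pMr// invf_lt1// ltr1n.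
  by apply: norm_row_le => [|j]; [rewrite divr_ge0// ltW|rewrite !mxE].
exists (b (\row_j q j, k)).
  split; first by exists (\row_j q j, k).
  by rewrite /b -ball_normE /ball_ /= distrC.
move=> w; rewrite /b -ball_normE /ball_ /= => qw; apply: xeV.
rewrite -ball_normE /ball_ /= -(subrKA (map_mx ratr (\row_j q j))).
apply: (le_lt_trans (ler_normD _ _)); rewrite [e]splitr.
by apply: ltrD; exact: lt_trans ke.
Qed.

Lemma euclidean_manifold : smooth_manifold B.
Proof.
split; first exact: norm_hausdorff.
- exact: second_countable_rV.
- by apply/seteqP; split => // y _; exists tt.
- move=> i; split; first exact: openT.
  + by move=> y y' _ _.
  + apply: continuous_subspaceT => y; exact: cvg_id.
  + by move=> O oO _; rewrite /= image_id.
split; first by move=> y _; exists tt.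
move=> i j /=; have E : [set y | y in setT `&` id @^-1` setT] = [set: 'rV[R]_n].
  by apply/seteqP; split=> // y _; exists y.
rewrite E; split; first exact: openT.
by rewrite euclidean_loc; apply: smooth_id; exact: openT.
Qed.

End EuclideanAtlas.

(** * Integral manifolds of [V_Cstar] *)

Section Leaf.
Context {R : realType} {M : topologicalType} {n : nat} {A : atlas R M n.+1}.
Variable K : cotangent A -> R.
Hypotheses (mfA : smooth_manifold A) (cK : cartan_structure K).
Local Notation A0 := (cot0 A).
Local Notation F := (polar_atlas K).
Local Notation B := (@euclidean_atlas R n).
Implicit Types (z : cotangent A) (i j : idx A0) (Q : 'M[R]_n.+1).
Let injA0 : chart_injective A0 := cot0_injective mfA.
Let injF := polar_injective mfA cK.
Let injB := @euclidean_injective R n.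

(** A slice in polar coordinates, with base point and value of K frozen; [plaque 0 0] describes its
    tangent vectors. *)
Definition plaque (x : 'rV[R]_n.+1) (r : R) (y : 'rV[R]_n) : 'rV[R]_(n.+1 + n.+1) :=
  row_mx x (row_mx (const_mx r : 'rV[R]_1) y : 'rV[R]_(1 + n)).

Lemma plaque_inj x x' r r' y y' : plaque x r y = plaque x' r' y' -> y = y'.
Proof.
move=> /(congr1 (fun w => rsubmx (rsubmx w : 'rV[R]_(1 + n)))).
by rewrite /plaque !row_mxKr.
Qed.

Lemma plaque_r x r y : rsubmx (plaque x r y) 0 0 = r.
Proof.
have -> : 0 = lshift n (0 : 'I_1) by apply/val_inj.
by rewrite row_mxKr (row_mxEl (n1 := 1)) mxE.
Qed.

Lemma plaque_eta w :
  plaque (lsubmx w) (rsubmx w 0 0) (rsubmx (rsubmx w : 'rV[R]_(1 + n))) = w.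
Proof.
rewrite /plaque -[RHS]hsubmxK; congr row_mx.
apply: etrans (@hsubmxK _ 1 1 n (rsubmx w)).
congr (row_mx _ _); apply/rowP => a; rewrite !mxE ord1.
by congr (w _ (rshift _ _)); exact/val_inj.
Qed.

Lemma smooth_plaque x r : smooth_on setT (plaque x r).
Proof.
apply: smooth_row_mx; [exact: openT|exact: smooth_cst|].
apply: (smooth_row_mx (n1 := 1)); [exact: openT|exact: smooth_cst|].
by apply: smooth_id; exact: openT.
Qed.

Lemma derive_plaque x r y v : 'D_v (plaque x r) y = plaque 0 0 v.
Proof.
have dp := smooth_differentiable_row openT (@smooth_plaque x r) (I : setT y).
apply/rowP => c; rewrite derive_row//.
case: (split_ordP c) => a ->.
  have -> : (fun w => plaque x r w 0 (lshift n.+1 a)) = cst (x 0 a).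
    by apply/funext => w; rewrite row_mxEl.
  by rewrite derive_cst row_mxEl mxE.
rewrite [RHS]row_mxEr; case: (split_ordP (a : 'I_(1 + n))) => d ad.
  have -> : (fun w => plaque x r w 0 (rshift n.+1 a)) = cst r.
    by apply/funext => w; rewrite row_mxEr ad (row_mxEl (n1 := 1)) mxE.
  by rewrite derive_cst ad (row_mxEl (n1 := 1)) mxE.
have -> : (fun w => plaque x r w 0 (rshift n.+1 a)) = (fun w : 'rV[R]_n => w 0 d).
  by apply/funext => w; rewrite row_mxEr ad (row_mxEr (n1 := 1)).
by rewrite -(derive_row _ _ (F := id))// derive_id ad (row_mxEr (n1 := 1)).
Qed.

(** The integral manifold through [z0] is the slice of a single polar chart [J]. It is parametrized
    by all rows y because [polar_target] puts no condition on y. *)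
Lemma V_Cstar_integrable : integrable_distribution n (V_Cstar K).
Proof.
move=> z0 [i iz0]; have [Q iQz0] := polar_cover K iz0.
have [_ uQ _] := iQz0; have [x0V r0] := polar_crd_target mfA cK iQz0.
pose J : idx F := (i, Q).
pose x := lsubmx (crd F J z0); pose r := rsubmx (crd F J z0) 0 0.
have leaf y : exists z, dom F J z /\ crd F J z = plaque x r y.
  have [|z Jz zy] := @polar_crd_surj _ _ _ _ _ mfA cK i Q (plaque x r y) uQ; last by exists z.
  split; rewrite ?row_mxKl ?row_mxKr//.
  by have := plaque_r x r y; rewrite row_mxKr => ->.
have [f /all_and2[Jf fE]] := choice leaf.
have if_ y : dom A0 i (f y) by have [] := Jf y.
have spf y : Defs.space A0 (f y) by exists i.
have BF : smooth_charts B F f tt J.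
  have E : crd B tt @` (dom B tt `&` f @^-1` dom F J) = setT.
    by apply/seteqP; split=> // y _; exists y => //; split => //; exact: Jf.
  rewrite /smooth_charts E euclidean_loc; split; first exact: openT.
  by have -> : crd F J \o f = plaque x r; [apply/funext => y; exact: fE|exact: smooth_plaque].
(* In chart [J] the map is the slice itself; the charts of both atlases are then reached through
   transitions. *)
have BA j : smooth_charts B A0 f tt j.
  apply: (@smooth_charts_comp _ _ _ _ _ _ _ B F A0 f id injB injF) => y _ _.
  by exists J; split => //; exact: polar_to_cot0.
have BF' J' : smooth_charts B F f tt J'.
  apply: (@smooth_charts_comp _ _ _ _ _ _ _ B A0 F f id injB injA0) => y _ _.
  by exists i; split => //; exact: cot0_to_polar.
have dplaque y (w : 'rV[R]_n) : 'D_w (@loc _ _ _ B _ tt (crd F J \o f)) y = plaque 0 0 w.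
  rewrite euclidean_loc; have -> : crd F J \o f = plaque x r; last exact: derive_plaque.
  by apply/funext => w'; exact: fE.
exists 'rV[R]_n, B, f, (rsubmx (rsubmx (crd F J z0) : 'rV[R]_(1 + n))); split; last first.
  apply: (injF (i := J)) => //.
  by rewrite fE plaque_eta.
split.
- exact: euclidean_manifold.
- move=> y y' eqf; have := fE y; by rewrite eqf fE => /plaque_inj ->.
- split; first by move=> y _; exact: spf.
  by move=> [] j; exact: BA.
(* Immersion: seen in chart [J], the differential sends [w] to [plaque 0 0 w], which determines
   [w]. *)
- move=> y w tw df0 [] _.
  have := @derive_charts_comp _ _ _ _ _ _ _ B A0 F f id injB injA0 tt i J y (w tt).
  move=> /(_ (BA i) (cot0_to_polar mfA cK i J) I (if_ y) (Jf y)).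
  rewrite -(df0 tt i I (if_ y)) derive0.
  rewrite dplaque -[X in _ = X -> _](plaque_eta 0) => /plaque_inj ->.
  by rewrite !linear0.
move=> y v; rewrite (V_Cstar_tangent_to_leaves mfA cK (spf y)); split.
  move=> [tv [wF dwF wF0]].
  (* The transverse part of [wF J] is zero, so its remaining components form the preimage under the
     differential. *)
  pose w := rsubmx (rsubmx (wF J) : 'rV[R]_(1 + n)).
  have wFE : wF J = plaque 0 0 w.
    have /transverse_eqP[wl wr] : forall c : 'I_(n.+1 + n.+1), (c < n.+2)%N ->
        wF J 0 c = (0 : 'rV[R]_(n.+1 + n.+1)) 0 c.
      by move=> c cn; rewrite (wF0 J (Jf y) _ cn) mxE.
    by rewrite -[LHS]plaque_eta wl wr linear0 !mxE.
  exists (fun=> w).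
    by move=> [] [] _ _; rewrite euclidean_loc derive_id.
  move=> [] j _ jf.
  have := @derive_charts_comp _ _ _ _ _ _ _ B F A0 f id injB injF tt J j y w.
  move=> /(_ BF (polar_to_cot0 mfA cK J j) I (Jf y) jf).
  rewrite dplaque -wFE (dwF j J jf (Jf y)) => ->.
  rewrite -(derive_charts_comp (A := A0) (B := F) (C := A0) (f := id) (g := id))//.
  - exact: tv.
  - exact: cot0_to_polar.
  - exact: polar_to_cot0.
move=> [w tw dfw].
have tv : tangent_at (f y) v.
  move=> j j' jf j'f; rewrite (dfw tt j I jf) (dfw tt j' I j'f).
  rewrite -(derive_charts_comp (A := B) (B := A0) (C := A0) (f := f) (g := id))//.
  exact: cot0_transition.
split => //; exists (fun J' => 'D_(w tt) (@loc _ _ _ B _ tt (crd F J' \o f)) y).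
  move=> j J' jf J'f; rewrite (dfw tt j I jf).
  rewrite -(derive_charts_comp (A := B) (B := A0) (C := F) (f := f) (g := id))//.
  exact: cot0_to_polar.
move=> J' J'f c cn; rewrite derive_row; last first.
  exact: (smooth_charts_differentiable (BF' J')).
rewrite euclidean_loc.
suff -> : (fun y' => (crd F J' \o f) y' 0 c) = cst (crd F J' (f y) 0 c).
  exact: derive_cst.
apply/funext => y'; move: c cn; apply/transverse_eqP.
have fbase y1 : base (f y1) = base (f y').
  have [b1 _] := if_ y1; have [b2 _] := if_ y'.
  apply: (manifold_injective mfA b1 b2).
  have := (polar_crd_transverse mfA J (f y1)).1; rewrite fE row_mxKl /= => <-.
  by have := (polar_crd_transverse mfA J (f y')).1; rewrite fE row_mxKl /= => <-.
have fK y1 : K (f y1) = r.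
  by rewrite -((polar_crd_transverse mfA J (f y1)).2 (if_ y1)) fE plaque_r.
(* [f y1] may lie outside the half space of [J'], but its base point is that of [f y]. This suffices
   for the transverse coordinates, which are thus constant on the whole slice. *)
have J'f1 y1 : dom A0 J'.1 (f y1).
  have [[b1 _] _ _] := J'f; split; last by have [] := if_ y1.
  by rewrite fbase -(fbase y).
rewrite !(polar_crd_transverse mfA J' _).1 !(polar_crd_transverse mfA J' _).2//.
by rewrite !fK (fbase y).
Qed.

End Leaf.
Theorem theorem2p1 (R : realType) (M : topologicalType) (n : nat)
    (A : atlas R M n) (K : cotangent A -> R) :
  smooth_manifold A -> cartan_structure K ->
  [/\ involutive_distribution (V_Cstar K),
      integrable_distribution n.-1 (V_Cstar K) &
      defines_foliation n.+1 (V_Cstar K)].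
Proof.
move=> mfA cK; split; first exact: V_Cstar_involutive.
(* The polar charts need a fibre coordinate q_0. For n = 0 every row is 0 by [thinmx0], so no
   nonzero covector exists and the claim is vacuous. *)
- case: n A K mfA cK => [|n] A K mfA cK; last exact: V_Cstar_integrable.
  move=> z [i [iz z0]]; case: z0; apply/funext => j; exact: thinmx0.
case: n A K mfA cK => [|n] A K mfA cK; last first.
  exists (polar_atlas K); first exact: polar_foliation.
  by move=> z spz; exact: V_Cstar_tangent_to_leaves.
have empty z : ~ Defs.space (cot0 A) z.
  move=> [i [iz z0]]; case: z0; apply/funext => j; exact: thinmx0.
(* With no points to cover, the induced atlas itself serves as foliated atlas. *)
exists (cot0 A); last by move=> z /empty.
have idA : smooth_map (cot0 A) (cot0 A) id.
  by split => // i j; exact: cot0_transition.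
split=> //; first exact/chart_injectiveP/(cot0_injective mfA).
by move=> i j z iz; case: (empty z); exists i.
Qed.
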